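(* Let $a,b\in\mathbb{R}[\sin t,\cos t]$ be real trigonometric polynomials (so $2\pi$-periodic), and assume that $b$ has only simple zeroes. Consider the scalar piecewise linear equation \[ x'=a(t)|x|+b(t), \] and for $x\in\mathbb{R}$ let $u(t,x)$ denote its solution with $u(0,x)=x$. Assume the following hypothesis: there exists an open interval $(x_1,x_2)$ such that for every $x\in(x_1,x_2)$ the function $t\mapsto u(t,x)$ has exactly two zeroes $t_1(x)<t_2(x)$ in $(0,2\pi)$, both simple, and such that \[ \lim_{x\to x_1^+}\big(t_2(x)-t_1(x)\big)=0\quad\text{or}\quad\lim_{x\to x_2^-}\big(t_2(x)-t_1(x)\big)=0. \] Then the equation has a global center (every solution is $2\pi$-periodic, i.e. $u(2\pi,x)=u(0,x)$ for all $x\in\mathbb{R}$) if and only if there exist polynomials $P,Q\in\mathbb{R}[x]$ and a trigonometric polynomial $h\in\mathbb{R}[\sin t,\cos t]$ such that \[ a(t)=P(h(t))\,h'(t),\qquad b(t)=Q(h(t))\,h'(t)\quad\text{for all } t. \]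
   Context: A solution $x(t)$ is called periodic if $x(0)=x(2\pi)$. A periodic solution is a center if it is not isolated in the set of periodic solutions, and the equation has a global center if every solution is periodic. A zero $t_0$ of $t\mapsto u(t,x)$ is simple if $u$ changes sign there / $\partial_t u(t_0,x)=b(t_0)\neq0$. *)

(* Defs.v *)
From Stdlib Require Import Reals.
From Coquelicot Require Import Coquelicot.
Open Scope R_scope.

Definition trig_poly (f : R -> R) : Prop :=
  exists (n : nat) (c : nat -> nat -> R), forall t : R,
    f t = sum_f_R0 (fun i => sum_f_R0 (fun j => c i j * sin t ^ i * cos t ^ j) n) n.

Definition poly_fun (P : R -> R) : Prop :=
  exists (n : nat) (c : nat -> R), forall y : R, P y = sum_f_R0 (fun k => c k * y ^ k) n.

Definition is_solution_map (a b : R -> R) (u : R -> R -> R) : Prop :=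
  forall x : R, u 0 x = x /\
    forall t : R, is_derive (fun s => u s x) t (a t * Rabs (u t x) + b t).

Definition simple_zeros (b : R -> R) : Prop :=
  forall t : R, b t = 0 -> Derive b t <> 0.

Definition global_center (u : R -> R -> R) : Prop :=
  forall x : R, u (2 * PI) x = u 0 x.

(* Main.v *)
(* A composition pulls the equation back from y' = P(s)|y| + Q(s) along s = h(t), and
   h(2 pi) = h(0).

   Conversely, solutions of constant sign show that in a center the primitive A of a is
   2 pi-periodic.  Solving the linear equations on both sides of the two zeros and
   differentiating in x gives A(t1) = A(t2) and a(t1) b(t2) = a(t2) b(t1), so that A and
   b/a, as rational functions of z = e^{it}, lie in the field K of fractions that take
   equal values at e^{i t1} and e^{i t2}.  By Lueroth's theorem K is generated by one
   fraction.  Since A has poles exactly at 0 and infinity, the generator can be chosen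
   to be either z^N, excluded since t2 - t1 -> 0, or a Laurent polynomial s with a pole
   at both places.  Then A is a polynomial in s and b dt = R(s) ds.  Complex conjugation
   acts on s by an affine map, so s is an affine function of h = Re s or h = Im s. *)
Require Import Defs.
From Stdlib Require Import Reals.
From Coquelicot Require Import Coquelicot.
From Stdlib Require Import Lra Lia PeanoNat Classical.
From mathcomp Require all_boot all_order all_algebra ring zify complex Rstruct.
Open Scope R_scope.

(** * Trigonometric polynomials *)

(** The identities between t1 and t2 hold for an interval of x, but the algebra sees them only along
    a sequence x_k tending to the endpoint where t2 - t1 -> 0, kept on one side of 0 so that t1(x_k)
    and t2(x_k) are injective in k. A nonzero polynomial then vanishes at finitely many of the
    points e^{i t1(x_k)}, e^{i t2(x_k)}, and an identity valid for all large k can be multiplied and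
    cancelled as in a field. So K is never built: it is replaced by a relation between numerators
    and denominators.

    The difficulty of the converse is to obtain polynomials and not merely rational functions. A
    Lueroth generator is only a fraction; the poles of A confine its poles to 0 and infinity, and an
    invariant Laurent polynomial is then expanded in powers of s by removing its poles. For b, it is
    the form b dt and not b itself that is expanded, and the only possible obstruction is a constant
    multiple of dz / z.

    Since the argument divides by a, the case a = 0 is separate: there h is a primitive of b,
    periodic because the solution starting at 0 is. *)

Lemma sum_f_R0_zero (f : nat -> R) (n : nat) : (forall k, f k = 0) -> sum_f_R0 f n = 0.
Proof. intros Hf. induction n as [|n IH]; simpl; rewrite ?IH, Hf; ring. Qed.

Lemma sum_f_R0_single (f : nat -> R) (i n : nat) : (i <= n)%nat ->
  sum_f_R0 (fun k => if Nat.eqb k i then f k else 0) n = f i.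
Proof.
  assert (Hz : forall m, (m < i)%nat ->
    sum_f_R0 (fun k => if Nat.eqb k i then f k else 0) m = 0).
  { induction m as [|m IH]; intros Hm; simpl.
    - destruct i; [lia | reflexivity].
    - rewrite IH by lia. destruct i as [|i]; [lia|].
      destruct (Nat.eqb_spec m i); [lia | lra]. }
  induction n as [|n IH]; intros Hi.
  - replace i with 0%nat by lia. reflexivity.
  - rewrite tech5. destruct (Nat.eqb_spec (S n) i) as [<-|Hn].
    + rewrite Hz by lia. lra.
    + rewrite IH by lia. lra.
Qed.

Lemma sum_f_R0_pad (f : nat -> R) (n m : nat) :
  sum_f_R0 (fun k => if Nat.leb k n then f k else 0) (n + m) = sum_f_R0 f n.
Proof.
  induction m as [|m IH].
  - rewrite Nat.add_0_r. apply sum_eq. intros i Hi.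
    destruct (Nat.leb_spec i n); [reflexivity | lia].
  - rewrite Nat.add_succ_r, tech5, IH.
    destruct (Nat.leb_spec (S (n + m)) n); [lia | lra].
Qed.

Lemma trig_poly_ext (f g : R -> R) : (forall t, f t = g t) -> trig_poly f -> trig_poly g.
Proof. intros H [n [c Hc]]. exists n, c. intros t. rewrite <- H. apply Hc. Qed.

Lemma trig_poly_monomial (c : R) (i j : nat) : trig_poly (fun t => c * sin t ^ i * cos t ^ j).
Proof.
  exists (i + j)%nat, (fun k l => if Nat.eqb k i then if Nat.eqb l j then c else 0 else 0).
  intros t.
  rewrite (sum_eq _ (fun k => if Nat.eqb k i then c * sin t ^ k * cos t ^ j else 0)).
  - rewrite (sum_f_R0_single (fun k => c * sin t ^ k * cos t ^ j)) by lia. reflexivity.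
  - intros k _. destruct (Nat.eqb_spec k i).
    + rewrite <- (sum_f_R0_single (fun l => c * sin t ^ k * cos t ^ l) j (i + j)) by lia.
      apply sum_eq. intros l _. destruct (Nat.eqb l j); ring.
    + apply sum_f_R0_zero. intros l. ring.
Qed.

Lemma trig_poly_pad (f : R -> R) (n : nat) (c : nat -> nat -> R) (m : nat) :
  (forall t, f t = sum_f_R0 (fun i => sum_f_R0 (fun j => c i j * sin t ^ i * cos t ^ j) n) n) ->
  exists c', forall t,
    f t = sum_f_R0 (fun i => sum_f_R0 (fun j => c' i j * sin t ^ i * cos t ^ j) (n + m)) (n + m).
Proof.
  intros H. exists (fun i j => if Nat.leb i n then if Nat.leb j n then c i j else 0 else 0).
  intros t. rewrite H, <- (sum_f_R0_pad _ n m). apply sum_eq. intros i _.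
  destruct (Nat.leb i n).
  - rewrite <- (sum_f_R0_pad _ n m). apply sum_eq. intros j _. destruct (Nat.leb j n); ring.
  - symmetry. apply sum_f_R0_zero. intros l. ring.
Qed.

Lemma trig_poly_plus (f g : R -> R) :
  trig_poly f -> trig_poly g -> trig_poly (fun t => f t + g t).
Proof.
  intros [n [c Hc]] [m [d Hd]].
  destruct (trig_poly_pad f n c m Hc) as [c' Hc'].
  destruct (trig_poly_pad g m d n Hd) as [d' Hd'].
  exists (n + m)%nat, (fun i j => c' i j + d' i j). intros t.
  rewrite Hc', Hd', (Nat.add_comm m n), <- sum_plus. apply sum_eq. intros i _.
  rewrite <- sum_plus. apply sum_eq. intros j _. ring.
Qed.

(** Monomials and sums generate everything, so the closure properties below never touch the double
    sum of coefficients. *)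
Lemma trig_poly_ind (P : (R -> R) -> Prop) :
  (forall f g, (forall t, f t = g t) -> P f -> P g) ->
  (forall c i j, P (fun t => c * sin t ^ i * cos t ^ j)) ->
  (forall f g, P f -> P g -> P (fun t => f t + g t)) ->
  forall f, trig_poly f -> P f.
Proof.
  intros Hext Hmono Hplus f [n [c Hc]].
  apply (Hext _ _ (fun t => eq_sym (Hc t))). clear f Hc.
  assert (Hsum : forall (F : nat -> R -> R) m, (forall i, P (F i)) ->
    P (fun t => sum_f_R0 (fun i => F i t) m)).
  { intros F m HF. induction m as [|m IH]; simpl.
    - apply (Hext (F 0%nat)); auto.
    - apply (Hplus _ _ IH). auto. }
  apply (Hsum (fun i t => sum_f_R0 (fun j => c i j * sin t ^ i * cos t ^ j) n)).
  intros i. apply (Hsum (fun j t => c i j * sin t ^ i * cos t ^ j)). auto.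
Qed.

Lemma trig_poly_mult (f g : R -> R) :
  trig_poly f -> trig_poly g -> trig_poly (fun t => f t * g t).
Proof.
  intros Hf Hg. revert f Hf. apply trig_poly_ind.
  - intros f f' H. apply trig_poly_ext. intros t. now rewrite H.
  - intros c i j. revert g Hg. apply trig_poly_ind.
    + intros f f' H. apply trig_poly_ext. intros t. now rewrite H.
    + intros d k l. apply (trig_poly_ext (fun t => (c * d) * sin t ^ (i + k) * cos t ^ (j + l))).
      * intros t. rewrite !pow_add. ring.
      * apply trig_poly_monomial.
    + intros f f' H H'. apply (trig_poly_ext _ _ (fun t => eq_sym (Rmult_plus_distr_l _ _ _))).
      now apply trig_poly_plus.
  - intros f f' H H'. apply (trig_poly_ext _ _ (fun t => eq_sym (Rmult_plus_distr_r _ _ _))).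
    now apply trig_poly_plus.
Qed.

Lemma trig_poly_const (c : R) : trig_poly (fun _ => c).
Proof.
  apply (trig_poly_ext (fun t => c * sin t ^ 0 * cos t ^ 0)).
  - intros t. simpl. ring.
  - apply trig_poly_monomial.
Qed.

Lemma trig_poly_scal (c : R) (f : R -> R) : trig_poly f -> trig_poly (fun t => c * f t).
Proof. intros Hf. apply (trig_poly_mult (fun _ => c)); [apply trig_poly_const | exact Hf]. Qed.

Lemma trig_poly_sin : trig_poly sin.
Proof.
  apply (trig_poly_ext (fun t => 1 * sin t ^ 1 * cos t ^ 0)).
  - intros t. simpl. ring.
  - apply trig_poly_monomial.
Qed.

Lemma trig_poly_cos : trig_poly cos.
Proof.
  apply (trig_poly_ext (fun t => 1 * sin t ^ 0 * cos t ^ 1)).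
  - intros t. simpl. ring.
  - apply trig_poly_monomial.
Qed.

Lemma trig_poly_bounded (f : R -> R) : trig_poly f -> exists M, 0 < M /\ forall t, Rabs (f t) <= M.
Proof.
  revert f. apply trig_poly_ind.
  - intros f g H [M [HM HM']]. exists M. split; [exact HM|]. intros t. now rewrite <- H.
  - intros c i j. exists (Rabs c + 1). split; [pose proof (Rabs_pos c); lra|]. intros t.
    assert (Hpow : forall x k, Rabs x <= 1 -> Rabs (x ^ k) <= 1).
    { intros x k Hx. rewrite <- RPow_abs. rewrite <- (pow1 k). apply pow_incr.
      split; [apply Rabs_pos | exact Hx]. }
    rewrite !Rabs_mult.
    assert (Hs : Rabs (sin t ^ i) <= 1) by (apply Hpow, Rabs_le, SIN_bound).
    assert (Hc : Rabs (cos t ^ j) <= 1) by (apply Hpow, Rabs_le, COS_bound).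
    pose proof (Rabs_pos c). pose proof (Rabs_pos (sin t ^ i)). pose proof (Rabs_pos (cos t ^ j)).
    assert (Rabs c * Rabs (sin t ^ i) <= Rabs c * 1) by now apply Rmult_le_compat_l.
    nra.
  - intros f g [M [HM Hf]] [N [HN Hg]]. exists (M + N). split; [lra|]. intros t.
    eapply Rle_trans; [apply Rabs_triang|]. apply Rplus_le_compat; auto.
Qed.

Lemma trig_poly_ex_derive (f : R -> R) : trig_poly f -> forall t, ex_derive f t.
Proof.
  revert f. apply (trig_poly_ind (fun f => forall t, ex_derive f t)).
  - intros f g H Hf t. now apply (ex_derive_ext f).
  - intros c i j t. auto_derive. auto.
  - intros f g Hf Hg t. apply (ex_derive_plus (V := R_NormedModule)); auto.
Qed.

Lemma trig_poly_continuous (f : R -> R) : trig_poly f -> forall t, continuous f t.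
Proof.
  intros Hf t. apply (ex_derive_continuous (V := R_NormedModule)), trig_poly_ex_derive, Hf.
Qed.

Lemma trig_poly_2PI (f : R -> R) : trig_poly f -> f (2 * PI) = f 0.
Proof.
  intros [n [c Hc]]. rewrite !Hc, sin_2PI, cos_2PI, sin_0, cos_0. reflexivity.
Qed.

(** * Primitives of trigonometric polynomials *)

(** The constant [c] is the mean of [f] over a period, the only obstruction to a trigonometric
    primitive. Periodicity of solutions makes it vanish later. *)
Definition has_trig_primitive (f : R -> R) : Prop :=
  exists (F : R -> R) (c : R), trig_poly F /\ forall t, is_derive F t (f t - c).

Lemma has_trig_primitive_ext (f g : R -> R) :
  (forall t, f t = g t) -> has_trig_primitive f -> has_trig_primitive g.
Proof.
  intros H [F [c [HF HF']]]. exists F, c. split; [exact HF|]. intros t. rewrite <- H. apply HF'.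
Qed.

Lemma has_trig_primitive_plus (f g : R -> R) :
  has_trig_primitive f -> has_trig_primitive g -> has_trig_primitive (fun t => f t + g t).
Proof.
  intros [F [c [HF HF']]] [G [d [HG HG']]].
  exists (fun t => F t + G t), (c + d). split; [now apply trig_poly_plus|]. intros t.
  replace (f t + g t - (c + d)) with ((f t - c) + (g t - d)) by ring.
  now apply (is_derive_plus (V := R_NormedModule)).
Qed.

Lemma has_trig_primitive_scal (k : R) (f : R -> R) :
  has_trig_primitive f -> has_trig_primitive (fun t => k * f t).
Proof.
  intros [F [c [HF HF']]].
  exists (fun t => k * F t), (k * c). split; [now apply trig_poly_scal|]. intros t.
  replace (k * f t - k * c) with (k * (f t - c)) by ring.
  now apply is_derive_scal.
Qed.

Lemma has_trig_primitive_derive (F f : R -> R) :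
  trig_poly F -> (forall t, is_derive F t (f t)) -> has_trig_primitive f.
Proof. intros HF HF'. exists F, 0. split; [exact HF|]. intros t. now rewrite Rminus_0_r. Qed.

Lemma sin_sqr (t : R) : sin t * sin t = 1 - cos t * cos t.
Proof. pose proof (sin2_cos2 t). unfold Rsqr in *. lra. Qed.

(** The derivative of - sin^{i+1} cos relates the exponents i + 2 and i, so two consecutive
    exponents are carried through the induction. The next lemma does the same in j with sin^{i+1}
    cos^{j+1}. *)
Lemma has_trig_primitive_sin_pow (i : nat) :
  has_trig_primitive (fun t => sin t ^ i) /\ has_trig_primitive (fun t => sin t ^ S i).
Proof.
  induction i as [|i [IH1 IH2]]; split.
  - exists (fun _ => 0), 1. split; [apply trig_poly_const|]. intros t.
    replace (sin t ^ 0 - 1) with 0 by (simpl; ring). auto_derive; auto.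
  - apply (has_trig_primitive_derive (fun t => -1 * cos t)).
    + apply trig_poly_scal, trig_poly_cos.
    + intros t. auto_derive; [exact I | ring].
  - exact IH2.
  - apply (has_trig_primitive_ext (fun t => / (INR i + 2) *
      (- ((INR i + 1) * sin t ^ i * cos t ^ 2 - sin t ^ S (S i)) + (INR i + 1) * sin t ^ i))).
    + intros t. pose proof (pos_INR i). simpl.
      replace (cos t * (cos t * 1)) with (1 - sin t * sin t) by (rewrite sin_sqr; ring).
      field. lra.
    + apply has_trig_primitive_scal, has_trig_primitive_plus;
        [|now apply has_trig_primitive_scal].
      apply (has_trig_primitive_derive (fun t => -1 * sin t ^ S i * cos t ^ 1)).
      * apply trig_poly_monomial.
      * intros t. auto_derive; [exact I|].
        change (match i with 0%nat => 1 | S _ => INR i + 1 end) with (INR (S i)).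
        rewrite S_INR. simpl. ring.
Qed.

Lemma has_trig_primitive_monomial (i j : nat) :
  has_trig_primitive (fun t => sin t ^ i * cos t ^ j) /\
  has_trig_primitive (fun t => sin t ^ i * cos t ^ S j).
Proof.
  induction j as [|j [IH1 IH2]]; split.
  - apply (has_trig_primitive_ext (fun t => sin t ^ i)); [intros t; simpl; ring|].
    apply has_trig_primitive_sin_pow.
  - apply (has_trig_primitive_derive (fun t => / (INR i + 1) * sin t ^ S i * cos t ^ 0)).
    + apply trig_poly_monomial.
    + intros t. pose proof (pos_INR i). auto_derive; [exact I|].
      change (match i with 0%nat => 1 | S _ => INR i + 1 end) with (INR (S i)).
      rewrite S_INR. simpl. field. lra.
  - exact IH2.
  - apply (has_trig_primitive_ext (fun t => / (INR i + INR j + 2) *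
      (((INR i + 1) * sin t ^ i * cos t ^ S (S j)
          - (INR j + 1) * (sin t ^ S (S i) * cos t ^ j))
        + (INR j + 1) * (sin t ^ i * cos t ^ j)))).
    + intros t. pose proof (pos_INR i). pose proof (pos_INR j). simpl.
      replace (sin t * (sin t * sin t ^ i)) with ((1 - cos t * cos t) * sin t ^ i)
        by (rewrite <- sin_sqr; ring).
      field. lra.
    + apply has_trig_primitive_scal, has_trig_primitive_plus;
        [|now apply has_trig_primitive_scal].
      apply (has_trig_primitive_derive (fun t => 1 * sin t ^ S i * cos t ^ S j)).
      * apply trig_poly_monomial.
      * intros t. auto_derive; [exact I|].
        change (match i with 0%nat => 1 | S _ => INR i + 1 end) with (INR (S i)).
        change (match j with 0%nat => 1 | S _ => INR j + 1 end) with (INR (S j)).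
        rewrite !S_INR. simpl. ring.
Qed.

Lemma trig_poly_primitive (f : R -> R) : trig_poly f -> has_trig_primitive f.
Proof.
  revert f. apply trig_poly_ind.
  - apply has_trig_primitive_ext.
  - intros c i j. apply (has_trig_primitive_ext (fun t => c * (sin t ^ i * cos t ^ j))).
    + intros t. ring.
    + apply has_trig_primitive_scal, has_trig_primitive_monomial.
  - apply has_trig_primitive_plus.
Qed.

(** * Existence of solutions by Picard iteration *)

Lemma is_derive_continuity_pt (f : R -> R) (x l : R) : is_derive f x l -> continuity_pt f x.
Proof.
  intros H. apply continuity_pt_filterlim.
  apply (ex_derive_continuous (V := R_NormedModule)). now exists l.
Qed.

Lemma derive_nonneg_le (f f' : R -> R) (a b : R) : a <= b ->
  (forall t, a <= t <= b -> is_derive f t (f' t)) ->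
  (forall t, a <= t <= b -> 0 <= f' t) -> f a <= f b.
Proof.
  intros Hab Hd Hpos.
  destruct (MVT_gen f a b f') as [c [Hc Heq]];
    rewrite ?Rmin_left, ?Rmax_right in * by lra.
  - intros t Ht. apply Hd. lra.
  - intros t Ht. apply (is_derive_continuity_pt f t (f' t)), Hd. lra.
  - specialize (Hpos c Hc). nra.
Qed.

Lemma derive_zero_eq (f : R -> R) (a b : R) : a <= b ->
  (forall t, a <= t <= b -> is_derive f t 0) -> f a = f b.
Proof.
  intros Hab Hd.
  assert (H1 : f a <= f b) by (apply (derive_nonneg_le f (fun _ => 0)); auto; intros; lra).
  assert (H2 : - f a <= - f b).
  { apply (derive_nonneg_le (fun t => - f t) (fun _ => - 0)); auto.
    - intros t Ht. apply (is_derive_opp (V := R_NormedModule)), Hd, Ht.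
    - intros; lra. }
  lra.
Qed.

Lemma Rabs_le_half_pow_eq0 (x C : R) : (forall n, Rabs x <= C * (/ 2) ^ n) -> x = 0.
Proof.
  intros H. destruct (Req_dec x 0) as [|Hx]; [assumption|exfalso].
  assert (Hx' : 0 < Rabs x) by now apply Rabs_pos_lt.
  assert (HC : 0 < C) by (specialize (H 0%nat); simpl in H; lra).
  destruct (pow_lt_1_zero (/ 2)) with (y := Rabs x / C) as [N HN].
  - rewrite Rabs_pos_eq; lra.
  - apply Rdiv_lt_0_compat; lra.
  - specialize (HN N (le_n N)). specialize (H N).
    rewrite Rabs_pos_eq in HN by (apply pow_le; lra).
    apply (Rmult_lt_compat_l C) in HN; [|lra].
    replace (C * (Rabs x / C)) with (Rabs x) in HN by (field; lra). lra.
Qed.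

Section Picard.
Variables (p q : R -> R) (K s0 x0 : R).
Hypothesis K_pos : 0 < K.
Hypothesis p_cont : forall s, continuous p s.
Hypothesis q_cont : forall s, continuous q s.
Hypothesis p_le : forall s, Rabs (p s) <= K.
Hypothesis q_le : forall s, Rabs (q s) <= K.

Definition picard_rhs (y : R -> R) (s : R) : R := p s * Rabs (y s) + q s.
Definition picard_step (y : R -> R) (s : R) : R := x0 + RInt (picard_rhs y) s0 s.
(** Bielecki's weight. Integrating K exp (2 K |s - s0|) away from s0 gives at most half of exp (2 K
    |s - s0|), so the Picard operator halves weighted distances on the whole line and solutions are
    global at once. *)
Definition picard_weight (s : R) : R := exp (2 * K * Rabs (s - s0)).

Lemma picard_rhs_continuous (y : R -> R) :
  (forall s, continuous y s) -> forall s, continuous (picard_rhs y) s.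
Proof.
  intros Hy s. unfold picard_rhs.
  apply (continuous_plus (V := R_NormedModule)); [|apply q_cont].
  apply (continuous_mult (K := R_AbsRing)); [apply p_cont|].
  apply (continuous_comp y Rabs); [apply Hy | apply continuous_Rabs].
Qed.

Lemma picard_step_derive (y : R -> R) :
  (forall s, continuous y s) -> forall s, is_derive (picard_step y) s (picard_rhs y s).
Proof.
  intros Hy s. unfold picard_step.
  replace (picard_rhs y s) with (0 + picard_rhs y s) by ring.
  apply (is_derive_plus (V := R_NormedModule)); [auto_derive; auto|].
  apply (is_derive_RInt (V := R_CompleteNormedModule) (picard_rhs y) _ s0).
  - exists (mkposreal 1 Rlt_0_1). intros t _.
    apply (RInt_correct (V := R_CompleteNormedModule)), ex_RInt_continuous.
    intros r _. now apply picard_rhs_continuous.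
  - now apply picard_rhs_continuous.
Qed.

Lemma picard_step_init (y : R -> R) : picard_step y s0 = x0.
Proof. unfold picard_step. rewrite RInt_point. apply Rplus_0_r. Qed.

Lemma picard_step_continuous (y : R -> R) :
  (forall s, continuous y s) -> forall s, continuous (picard_step y) s.
Proof.
  intros Hy s. apply (ex_derive_continuous (V := R_NormedModule)).
  exists (picard_rhs y s). now apply picard_step_derive.
Qed.

Lemma picard_weight_ge1 (s : R) : 1 <= picard_weight s.
Proof.
  unfold picard_weight. rewrite <- exp_0.
  assert (0 <= 2 * K * Rabs (s - s0)) by (pose proof (Rabs_pos (s - s0)); nra).
  destruct (Rle_lt_or_eq_dec _ _ H) as [Hlt|<-]; [left; now apply exp_increasing | right; reflexivity].
Qed.

(** D / 2 times the weight has slope K D times the weight away from s0, so it dominates both phi and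
    - phi, on each side of s0. *)
Lemma weighted_derive_bound (phi phi' : R -> R) (D : R) :
  phi s0 = 0 -> (forall s, is_derive phi s (phi' s)) ->
  (forall s, Rabs (phi' s) <= K * D * picard_weight s) ->
  forall s, Rabs (phi s) <= D / 2 * picard_weight s.
Proof.
  intros H0 Hd Hb s.
  assert (HD : 0 <= D).
  { specialize (Hb s0). pose proof (Rabs_pos (phi' s0)). pose proof (picard_weight_ge1 s0).
    apply Rnot_lt_le. intros HD. assert (K * D < 0) by nra. nra. }
  unfold picard_weight in *.
  assert (Hsign : forall e, e = 1 \/ e = -1 -> e * phi s <= D / 2 * exp (2 * K * Rabs (s - s0))).
  { intros e He.
    assert (Hb' : forall t, - (K * D * exp (2 * K * Rabs (t - s0))) <= e * phi' t
                          <= K * D * exp (2 * K * Rabs (t - s0))).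
    { intros t. specialize (Hb t). apply Rabs_le_between in Hb. destruct He as [-> | ->]; lra. }
    destruct (Rle_dec s0 s) as [Hs|Hs].
    - assert (H : D / 2 * exp (2 * K * (s0 - s0)) - e * phi s0
                   <= D / 2 * exp (2 * K * (s - s0)) - e * phi s).
      { apply (derive_nonneg_le (fun t => D / 2 * exp (2 * K * (t - s0)) - e * phi t)
          (fun t => K * D * exp (2 * K * (t - s0)) - e * phi' t)); auto.
        - intros t _. apply (is_derive_minus (V := R_NormedModule)).
          + auto_derive; [exact I | unfold Rminus; field].
          + now apply is_derive_scal.
        - intros t Ht. specialize (Hb' t). rewrite Rabs_pos_eq in Hb' by lra. lra. }
      rewrite Rabs_pos_eq by lra.
      rewrite H0, Rminus_diag, Rmult_0_r, exp_0 in H. lra.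
    - assert (H : - (D / 2 * exp (2 * K * (s0 - s)) - e * phi s)
                   <= - (D / 2 * exp (2 * K * (s0 - s0)) - e * phi s0)).
      { apply (derive_nonneg_le (fun t => - (D / 2 * exp (2 * K * (s0 - t)) - e * phi t))
          (fun t => - (- K * D * exp (2 * K * (s0 - t)) - e * phi' t))); [lra| |].
        - intros t _. apply (is_derive_opp (V := R_NormedModule)).
          apply (is_derive_minus (V := R_NormedModule)).
          + auto_derive; [exact I | unfold Rminus; field].
          + now apply is_derive_scal.
        - intros t Ht. specialize (Hb' t). rewrite Rabs_left1 in Hb' by lra.
          replace (- (t - s0)) with (s0 - t) in Hb' by ring. lra. }
      rewrite Rabs_left by lra. replace (- (s - s0)) with (s0 - s) by ring.
      rewrite H0, Rminus_diag, Rmult_0_r, exp_0 in H. lra. }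
  pose proof (Hsign 1 (or_introl eq_refl)). pose proof (Hsign (-1) (or_intror eq_refl)).
  apply Rabs_le_between. lra.
Qed.

Lemma picard_step_contract (y y' : R -> R) (D : R) :
  (forall s, continuous y s) -> (forall s, continuous y' s) ->
  (forall s, Rabs (y s - y' s) <= D * picard_weight s) ->
  forall s, Rabs (picard_step y s - picard_step y' s) <= D / 2 * picard_weight s.
Proof.
  intros Hy Hy' Hb.
  apply (weighted_derive_bound (fun s => picard_step y s - picard_step y' s)
           (fun s => picard_rhs y s - picard_rhs y' s)).
  - rewrite !picard_step_init. ring.
  - intros s. apply (is_derive_minus (V := R_NormedModule)); now apply picard_step_derive.
  - intros s. unfold picard_rhs.
    replace (p s * Rabs (y s) + q s - (p s * Rabs (y' s) + q s))
      with (p s * (Rabs (y s) - Rabs (y' s))) by ring.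
    rewrite Rabs_mult, Rmult_assoc.
    apply Rmult_le_compat; auto using Rabs_pos.
    eapply Rle_trans; [apply Rabs_triang_inv2 | apply Hb].
Qed.

Fixpoint picard_iter (n : nat) : R -> R :=
  match n with
  | O => fun _ => x0
  | S n => picard_step (picard_iter n)
  end.

Lemma picard_iter_continuous (n : nat) : forall s, continuous (picard_iter n) s.
Proof.
  induction n as [|n IH]; simpl.
  - intros s. apply continuous_const.
  - now apply picard_step_continuous.
Qed.

(** D / 2 bounds the first Picard step relative to the weight, and D the geometric sum of all
    steps. *)
Let D := 2 * (Rabs x0 + 1).

Lemma picard_iter_step (n : nat) (s : R) :
  Rabs (picard_iter (S n) s - picard_iter n s) <= D / 2 * (/ 2) ^ n * picard_weight s.
Proof.
  revert s. induction n as [|n IH]; intros s.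
  - simpl. rewrite Rmult_1_r.
    apply (weighted_derive_bound (fun s => picard_step (fun _ => x0) s - x0)
             (fun s => picard_rhs (fun _ => x0) s - 0)).
    + rewrite picard_step_init. ring.
    + intros t. apply (is_derive_minus (V := R_NormedModule)).
      * apply picard_step_derive. intros r. apply continuous_const.
      * auto_derive; auto.
    + intros t. rewrite Rminus_0_r. unfold picard_rhs, D.
      pose proof (picard_weight_ge1 t). pose proof (p_le t). pose proof (q_le t).
      pose proof (Rabs_pos x0). pose proof (Rabs_pos (p t)).
      assert (Rabs (p t * Rabs x0 + q t) <= K * Rabs x0 + K).
      { eapply Rle_trans; [apply Rabs_triang|]. rewrite Rabs_mult, Rabs_Rabsolu.
        apply Rplus_le_compat; [|assumption]. now apply Rmult_le_compat_r. }
      assert (0 <= K * (Rabs x0 + 1)) by nra. nra.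
  - replace (D / 2 * (/ 2) ^ S n) with (D / 2 * (/ 2) ^ n / 2) by (simpl; field).
    apply (picard_step_contract (picard_iter (S n)) (picard_iter n));
      auto using picard_iter_continuous.
Qed.

Lemma picard_iter_cauchy (n k : nat) (s : R) :
  Rabs (picard_iter (n + k) s - picard_iter n s) <= D * (/ 2) ^ n * picard_weight s.
Proof.
  assert (H : Rabs (picard_iter (n + k) s - picard_iter n s)
              <= D * ((/ 2) ^ n - (/ 2) ^ (n + k)) * picard_weight s).
  { induction k as [|k IH].
    - rewrite Nat.add_0_r, !Rminus_diag, Rabs_R0. lra.
    - rewrite Nat.add_succ_r. pose proof (picard_iter_step (n + k) s) as Hs.
      replace (picard_iter (S (n + k)) s - picard_iter n s)
        with ((picard_iter (S (n + k)) s - picard_iter (n + k) s)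
              + (picard_iter (n + k) s - picard_iter n s)) by ring.
      eapply Rle_trans; [apply Rabs_triang|]. simpl ((/ 2) ^ S (n + k)). lra. }
  eapply Rle_trans; [exact H|].
  assert (0 <= (/ 2) ^ (n + k)) by (apply pow_le; lra).
  pose proof (picard_weight_ge1 s). pose proof (Rabs_pos x0).
  assert (0 <= D) by (unfold D; lra).
  apply Rmult_le_compat_r; [lra|]. apply Rmult_le_compat_l; lra.
Qed.

Lemma picard_iter_converges (s : R) : { l : R | Un_cv (fun n => picard_iter n s) l }.
Proof.
  apply Rcomplete.R_complete. intros eps Heps.
  pose proof (picard_weight_ge1 s) as HW. pose proof (Rabs_pos x0) as Hx.
  assert (HD : 0 < D) by (unfold D; lra).
  destruct (pow_lt_1_zero (/ 2)) with (y := eps / (2 * (D * picard_weight s))) as [N HN].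
  { rewrite Rabs_pos_eq; lra. }
  { apply Rdiv_lt_0_compat; nra. }
  assert (Hb : forall n, (N <= n)%nat ->
    Rabs (picard_iter n s - picard_iter N s) < eps / 2).
  { intros n Hn. replace n with (N + (n - N))%nat by lia.
    eapply Rle_lt_trans; [apply picard_iter_cauchy|].
    specialize (HN N (le_n N)). rewrite Rabs_pos_eq in HN by (apply pow_le; lra).
    assert (0 < D * picard_weight s) by nra.
    apply (Rmult_lt_compat_l (D * picard_weight s)) in HN; [|assumption].
    replace (D * picard_weight s * (eps / (2 * (D * picard_weight s)))) with (eps / 2) in HN
      by (field; lra). lra. }
  exists N. intros n m Hn Hm. unfold Rdist.
  replace (picard_iter n s - picard_iter m s)
    with ((picard_iter n s - picard_iter N s) - (picard_iter m s - picard_iter N s)) by ring.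
  eapply Rle_lt_trans; [apply Rabs_triang|]. rewrite Rabs_Ropp.
  pose proof (Hb n Hn). pose proof (Hb m Hm). lra.
Qed.

Definition picard_limit (s : R) : R := proj1_sig (picard_iter_converges s).

Lemma picard_limit_bound (n : nat) (s : R) :
  Rabs (picard_limit s - picard_iter n s) <= D * (/ 2) ^ n * picard_weight s.
Proof.
  apply le_epsilon. intros eps Heps.
  destruct (proj2_sig (picard_iter_converges s) eps Heps) as [N HN].
  fold (picard_limit s) in HN.
  specialize (HN (n + N)%nat ltac:(lia)). unfold Rdist in HN.
  pose proof (picard_iter_cauchy n N s).
  replace (picard_limit s - picard_iter n s)
    with (- (picard_iter (n + N) s - picard_limit s)
          + (picard_iter (n + N) s - picard_iter n s)) by ring.
  eapply Rle_trans; [apply Rabs_triang|]. rewrite Rabs_Ropp. lra.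
Qed.

(** Within distance 1 of [s] the weight grows by a factor of at most exp (2 K), so the iterates
    converge uniformly there and an eps / 3 argument applies. *)
Lemma picard_limit_continuous (s : R) : continuous picard_limit s.
Proof.
  apply continuity_pt_filterlim. intros eps Heps.
  set (C := D * (picard_weight s * exp (2 * K))).
  assert (HC : 0 < C).
  { pose proof (picard_weight_ge1 s). pose proof (exp_pos (2 * K)). pose proof (Rabs_pos x0).
    unfold C, D. apply Rmult_lt_0_compat; [lra|]. apply Rmult_lt_0_compat; lra. }
  destruct (pow_lt_1_zero (/ 2)) with (y := eps / (3 * C)) as [N HN].
  { rewrite Rabs_pos_eq; lra. }
  { apply Rdiv_lt_0_compat; lra. }
  specialize (HN N (le_n N)). rewrite Rabs_pos_eq in HN by (apply pow_le; lra).
  assert (HN' : C * (/ 2) ^ N < eps / 3).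
  { apply (Rmult_lt_compat_l C) in HN; [|exact HC].
    replace (C * (eps / (3 * C))) with (eps / 3) in HN by (field; lra). exact HN. }
  assert (Hc : continuity_pt (picard_iter N) s)
    by apply continuity_pt_filterlim, picard_iter_continuous.
  destruct (Hc (eps / 3)) as [d [Hd Hcont]]; [lra|].
  exists (Rmin d 1). split; [apply Rmin_pos; lra|].
  intros t [HDt Ht]. simpl in *. unfold Rdist in *.
  assert (Ht1 : Rabs (t - s) < d) by (eapply Rlt_le_trans; [exact Ht | apply Rmin_l]).
  assert (Ht2 : Rabs (t - s) < 1) by (eapply Rlt_le_trans; [exact Ht | apply Rmin_r]).
  assert (Hw : forall r, Rabs (r - s) < 1 ->
    Rabs (picard_limit r - picard_iter N r) < eps / 3).
  { intros r Hr. eapply Rle_lt_trans; [apply picard_limit_bound|].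
    eapply Rle_lt_trans; [|exact HN'].
    assert (Hexp : picard_weight r <= picard_weight s * exp (2 * K)).
    { unfold picard_weight. rewrite <- exp_plus.
      assert (Hle : 2 * K * Rabs (r - s0) <= 2 * K * Rabs (s - s0) + 2 * K).
      { replace (r - s0) with ((r - s) + (s - s0)) by ring.
        pose proof (Rabs_triang (r - s) (s - s0)). nra. }
      destruct (Rle_lt_or_eq_dec _ _ Hle) as [Hlt | ->];
        [left; now apply exp_increasing | right; reflexivity]. }
    assert (0 <= D * (/ 2) ^ N).
    { apply Rmult_le_pos; [unfold D; pose proof (Rabs_pos x0); lra | apply pow_le; lra]. }
    unfold C. nra. }
  pose proof (Hw t Ht2) as H1. pose proof (Hw s) as H2. rewrite Rminus_diag, Rabs_R0 in H2.
  specialize (H2 Rlt_0_1).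
  assert (H3 : Rabs (picard_iter N t - picard_iter N s) < eps / 3).
  { destruct (Req_dec t s) as [-> | Hts].
    - rewrite Rminus_diag, Rabs_R0. lra.
    - apply Hcont. split; [split; [exact I | auto] | exact Ht1]. }
  replace (picard_limit t - picard_limit s)
    with ((picard_limit t - picard_iter N t) + (picard_iter N t - picard_iter N s)
          - (picard_limit s - picard_iter N s)) by ring.
  eapply Rle_lt_trans; [apply Rabs_triang|]. rewrite Rabs_Ropp.
  pose proof (Rabs_triang (picard_limit t - picard_iter N t) (picard_iter N t - picard_iter N s)).
  lra.
Qed.

Lemma picard_limit_fixed (s : R) : picard_limit s = picard_step picard_limit s.
Proof.
  apply Rminus_diag_uniq, (Rabs_le_half_pow_eq0 _ (D * picard_weight s)). intros n.
  pose proof (picard_limit_bound (S n) s) as H1. simpl ((/ 2) ^ S n) in H1.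
  simpl (picard_iter (S n) s) in H1.
  pose proof (picard_step_contract picard_limit (picard_iter n) (D * (/ 2) ^ n)
    picard_limit_continuous (picard_iter_continuous n) (picard_limit_bound n) s) as H2.
  replace (picard_limit s - picard_step picard_limit s)
    with ((picard_limit s - picard_step (picard_iter n) s)
          - (picard_step picard_limit s - picard_step (picard_iter n) s)) by ring.
  eapply Rle_trans; [apply Rabs_triang|]. rewrite Rabs_Ropp. lra.
Qed.

Lemma picard_solution :
  exists y : R -> R, y s0 = x0 /\ forall s, is_derive y s (p s * Rabs (y s) + q s).
Proof.
  exists picard_limit. split.
  - rewrite picard_limit_fixed. apply picard_step_init.
  - intros s. apply (is_derive_ext (picard_step picard_limit)).
    + intros t. now rewrite <- picard_limit_fixed.
    + apply (picard_step_derive picard_limit), picard_limit_continuous.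
Qed.
End Picard.

(** * Composition implies a global center *)

(** Gronwall in squared form: (w1 - w2)^2 exp (- 2 M t) does not increase, because the absolute
    value is 1-Lipschitz. It serves as uniqueness when the initial values agree, and as continuity
    in the initial value otherwise. *)
Lemma solution_dependence (a b w1 w2 : R -> R) (M : R) :
  (forall t, Rabs (a t) <= M) ->
  (forall t, is_derive w1 t (a t * Rabs (w1 t) + b t)) ->
  (forall t, is_derive w2 t (a t * Rabs (w2 t) + b t)) ->
  forall t, 0 <= t -> Rabs (w1 t - w2 t) <= Rabs (w1 0 - w2 0) * exp (M * t).
Proof.
  intros HM H1 H2 t Ht.
  set (E := fun s => (w1 s - w2 s) ^ 2 * exp (- (2 * M * s))).
  assert (HE : - E 0 <= - E t).
  { apply (derive_nonneg_le (fun s => - E s) (fun s =>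
      - ((2 * (a s * (Rabs (w1 s) - Rabs (w2 s))) * (w1 s - w2 s)
         - 2 * M * (w1 s - w2 s) ^ 2) * exp (- (2 * M * s))))); [exact Ht| |].
    - intros s _. unfold E. auto_derive.
      + repeat split; eexists; auto.
      + replace (Derive (fun x => w1 x) s) with (a s * Rabs (w1 s) + b s)
          by (symmetry; apply is_derive_unique, H1).
        replace (Derive (fun x => w2 x) s) with (a s * Rabs (w2 s) + b s)
          by (symmetry; apply is_derive_unique, H2).
        unfold Rminus. ring.
    - intros s _. rewrite Ropp_mult_distr_l. apply Rmult_le_pos; [|left; apply exp_pos].
      assert (Hb : Rabs (a s * (Rabs (w1 s) - Rabs (w2 s)) * (w1 s - w2 s))
                   <= M * (w1 s - w2 s) ^ 2).
      { rewrite !Rabs_mult, <- (pow2_abs (w1 s - w2 s)).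
        simpl. rewrite Rmult_1_r, <- Rmult_assoc. apply Rmult_le_compat_r; [apply Rabs_pos|].
        apply Rmult_le_compat; auto using Rabs_pos. apply Rabs_triang_inv2. }
      apply Rabs_le_between in Hb. lra. }
  unfold E in HE. rewrite Rmult_0_r, Ropp_0, exp_0, Rmult_1_r, exp_Ropp in HE.
  assert (Hexp : 0 < exp (2 * M * t)) by apply exp_pos.
  apply Rsqr_incr_0; [|apply Rabs_pos|apply Rmult_le_pos; [apply Rabs_pos | left; apply exp_pos]].
  rewrite Rsqr_mult, <- !Rsqr_abs. unfold Rsqr at 3. rewrite <- exp_plus.
  replace (M * t + M * t) with (2 * M * t) by ring.
  apply (Rmult_le_compat_r (exp (2 * M * t))) in HE; [|lra].
  replace (- ((w1 t - w2 t) ^ 2 * / exp (2 * M * t)) * exp (2 * M * t))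
    with (- (w1 t - w2 t) ^ 2) in HE by (field; lra).
  unfold Rsqr. lra.
Qed.

Lemma poly_fun_ex_derive (P : R -> R) : poly_fun P -> forall s, ex_derive P s.
Proof.
  intros [n [c Hc]] s. apply (ex_derive_ext (fun y => sum_f_R0 (fun k => c k * y ^ k) n)).
  - intros t. now rewrite Hc.
  - clear Hc. induction n as [|n IH]; simpl.
    + auto_derive; auto.
    + apply (ex_derive_plus (V := R_NormedModule)); [exact IH|]. auto_derive; auto.
Qed.

Lemma poly_fun_continuous (P : R -> R) : poly_fun P -> forall s, continuous P s.
Proof.
  intros HP s. apply (ex_derive_continuous (V := R_NormedModule)), poly_fun_ex_derive, HP.
Qed.

(** Along s = h(t) only the values of P on the bounded range of h matter. Freezing P outside gives a
    bounded coefficient, hence the global Lipschitz condition that the Picard section asks for. *)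
Lemma clamped_poly (P : R -> R) (M : R) : poly_fun P -> 0 < M ->
  exists p K, 0 < K /\ (forall s, continuous p s) /\ (forall s, Rabs (p s) <= K) /\
    (forall s, Rabs s <= M -> p s = P s).
Proof.
  intros HP HM. set (clamp := fun s => Rmax (- M) (Rmin M s)).
  assert (Hcl : forall s, - M <= clamp s <= M).
  { intros s. unfold clamp, Rmax, Rmin. repeat destruct Rle_dec; lra. }
  assert (Hcont : forall s, continuous clamp s).
  { intros s. apply continuity_pt_filterlim. intros eps Heps. exists eps.
    split; [exact Heps|]. intros t [_ Ht]. simpl in *. unfold Rdist in *.
    eapply Rle_lt_trans; [|exact Ht].
    unfold clamp, Rmax, Rmin, Rabs. repeat destruct Rle_dec; repeat destruct Rcase_abs; lra. }
  destruct (continuity_ab_maj (fun s => Rabs (P s)) (- M) M) as [m [Hm _]]; [lra| |].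
  { intros c _. apply continuity_pt_filterlim. apply (continuous_comp P Rabs).
    - now apply poly_fun_continuous.
    - apply continuous_Rabs. }
  exists (fun s => P (clamp s)), (Rabs (P m) + 1). repeat split.
  - pose proof (Rabs_pos (P m)). lra.
  - intros s. apply (continuous_comp clamp P); [apply Hcont | now apply poly_fun_continuous].
  - intros s. specialize (Hm _ (Hcl s)). lra.
  - intros s Hs. apply Rabs_le_between in Hs. f_equal.
    unfold clamp, Rmax, Rmin. repeat destruct Rle_dec; lra.
Qed.

Lemma composition_global_center (a b : R -> R) (u : R -> R -> R) (P Q h : R -> R) :
  trig_poly a -> is_solution_map a b u ->
  poly_fun P -> poly_fun Q -> trig_poly h ->
  (forall t, a t = P (h t) * Derive h t /\ b t = Q (h t) * Derive h t) ->
  global_center u.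
Proof.
  intros Ha Hu HP HQ Hh Hab x.
  destruct (trig_poly_bounded h Hh) as [M [HM HhM]].
  destruct (trig_poly_bounded a Ha) as [N [HN HaN]].
  destruct (clamped_poly P M HP HM) as [p [K [HK [Hp [HpK HpP]]]]].
  destruct (clamped_poly Q M HQ HM) as [q [L [HL [Hq [HqL HqQ]]]]].
  destruct (picard_solution p q (K + L) (h 0) x) as [y [Hy0 Hy]]; try assumption.
  - lra.
  - intros s. specialize (HpK s). lra.
  - intros s. specialize (HqL s). lra.
  - assert (Hyh : forall t, is_derive (fun s => y (h s)) t (a t * Rabs (y (h t)) + b t)).
    { intros t. destruct (Hab t) as [-> ->].
      replace (P (h t) * Derive h t * Rabs (y (h t)) + Q (h t) * Derive h t)
        with (Derive h t * (p (h t) * Rabs (y (h t)) + q (h t)))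
        by (rewrite HpP, HqQ by auto; ring).
      apply (is_derive_comp (V := R_NormedModule)); [apply Hy|].
      apply Derive_correct, trig_poly_ex_derive, Hh. }
    assert (Heq : forall t, 0 <= t -> u t x = y (h t)).
    { intros t Ht. apply Rminus_diag_uniq.
      pose proof (solution_dependence a b (fun s => u s x) (fun s => y (h s)) N HaN
        (proj2 (Hu x)) Hyh t Ht) as Hd. simpl in Hd.
      rewrite (proj1 (Hu x)), Hy0, Rminus_diag, Rabs_R0, Rmult_0_l in Hd.
      apply Rabs_le_between in Hd. lra. }
    rewrite !Heq by (pose proof PI_RGT_0; lra). now rewrite (trig_poly_2PI h Hh).
Qed.

(** * Zeros of the solutions of a global center *)

Lemma no_zero_sign (f : R -> R) (p q s t : R) :
  continuity f -> (forall r, p <= r <= q -> f r <> 0) ->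
  p <= s <= q -> p <= t <= q -> 0 < f s -> 0 < f t.
Proof.
  intros Hf Hnz Hs Ht Hfs. apply Rnot_le_lt. intros Hft.
  destruct (Rle_dec s t) as [Hst|Hst].
  - destruct (IVT_cor f s t Hf Hst) as [z [Hz Hz0]]; [nra|]. apply (Hnz z); [lra | exact Hz0].
  - destruct (IVT_cor f t s Hf ltac:(lra)) as [z [Hz Hz0]]; [nra|].
    apply (Hnz z); [lra | exact Hz0].
Qed.

Lemma simple_zero_sign (f : R -> R) (x l : R) : is_derive f x l -> f x = 0 -> l <> 0 ->
  exists d, 0 < d /\ forall h, h <> 0 -> Rabs h < d -> 0 < l * h * f (x + h).
Proof.
  intros Hf Hx Hl. apply is_derive_Reals in Hf.
  destruct (Hf (Rabs l) (Rabs_pos_lt l Hl)) as [d Hd].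
  exists d. split; [apply cond_pos|]. intros h Hh Hhd.
  specialize (Hd h Hh Hhd). rewrite Hx, Rminus_0_r in Hd.
  assert (Hq : f (x + h) = h * (f (x + h) / h)) by (field; exact Hh).
  rewrite Hq. replace (l * h * (h * (f (x + h) / h))) with (h ^ 2 * (l * (f (x + h) / h))) by ring.
  apply Rmult_lt_0_compat; [now apply pow2_gt_0|].
  revert Hd. generalize (f (x + h) / h). intros r Hr. clear - Hr Hl.
  unfold Rabs in Hr. destruct (Rcase_abs l), (Rcase_abs (r - l)); nra.
Qed.

(** The sign change between [x - e] and [x + e] survives any perturbation smaller than |f| at these
    two points, and the intermediate value theorem returns a zero. *)
Lemma simple_zero_persists (f : R -> R) (x l eps : R) :
  is_derive f x l -> f x = 0 -> l <> 0 -> 0 < eps ->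
  exists e m, 0 < e < eps /\ 0 < m /\ forall g, continuity g ->
    Rabs (g (x - e) - f (x - e)) < m -> Rabs (g (x + e) - f (x + e)) < m ->
    exists z, x - e <= z <= x + e /\ g z = 0.
Proof.
  intros Hf Hx Hl Heps. destruct (simple_zero_sign f x l Hf Hx Hl) as [d [Hd Hs]].
  set (e := Rmin eps d / 2).
  assert (He : 0 < e /\ e < eps /\ e < d).
  { unfold e, Rmin. destruct Rle_dec; lra. }
  pose proof (Hs e ltac:(lra) ltac:(rewrite Rabs_pos_eq; lra)) as H1.
  pose proof (Hs (- e) ltac:(lra) ltac:(rewrite Rabs_Ropp, Rabs_pos_eq; lra)) as H2.
  change (x + - e) with (x - e) in H2.
  assert (Hopp : f (x - e) * f (x + e) < 0).
  { assert (0 < l ^ 2 * e ^ 2) by (apply Rmult_lt_0_compat; apply pow2_gt_0; lra).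
    assert (0 < (l * e * f (x + e)) * (l * - e * f (x - e))) by now apply Rmult_lt_0_compat.
    nra. }
  exists e, (Rmin (Rabs (f (x - e))) (Rabs (f (x + e)))). split; [lra|]. split.
  - apply Rmin_pos; apply Rabs_pos_lt; intros H; rewrite H in Hopp; lra.
  - intros g Hg Hm Hp.
    assert (Hm' := Rlt_le_trans _ _ _ Hm (Rmin_l _ _)).
    assert (Hp' := Rlt_le_trans _ _ _ Hp (Rmin_r _ _)).
    destruct (IVT_cor g (x - e) (x + e) Hg ltac:(lra)) as [z Hz]; [|now exists z].
    clear - Hopp Hm' Hp'.
    unfold Rabs in *. repeat destruct Rcase_abs; nra.
Qed.

(** The difference quotient of g is the inverse of that of f between g x and g (x + h); continuity
    of g sends the increment of g to 0. *)
Lemma inverse_derive (f g : R -> R) (x l : R) :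
  is_derive f (g x) l -> l <> 0 -> continuity_pt g x ->
  (exists d, 0 < d /\ forall y, Rabs (y - x) < d -> f (g y) = y) ->
  is_derive g x (/ l).
Proof.
  intros Hf Hl Hg [d [Hd Hinv]]. apply is_derive_Reals. apply is_derive_Reals in Hf.
  intros eps Heps.
  assert (Hl' : 0 < Rabs l) by now apply Rabs_pos_lt.
  (* The first bound keeps the quotient r of f above |l| / 2 in absolute value; the second then
     makes |1/r - 1/l| = |r - l| / |r l| smaller than eps. *)
  set (eta := Rmin (Rabs l / 2) (eps * Rabs l ^ 2 / 4)).
  assert (Heta : 0 < eta).
  { apply Rmin_pos; [lra|]. pose proof (pow_lt _ 2 Hl'). nra. }
  destruct (Hf eta Heta) as [d1 Hd1].
  destruct (Hg d1 (cond_pos d1)) as [d2 [Hd2 Hgc]].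
  exists (mkposreal (Rmin d d2) (Rmin_pos _ _ Hd Hd2)). intros h Hh Hhd. simpl in Hhd.
  assert (Hhd1 := Rlt_le_trans _ _ _ Hhd (Rmin_l _ _)).
  assert (Hhd2 := Rlt_le_trans _ _ _ Hhd (Rmin_r _ _)).
  assert (E1 : f (g (x + h)) = x + h) by (apply Hinv; now replace (x + h - x) with h by ring).
  assert (E0 : f (g x) = x) by (apply Hinv; now rewrite Rminus_diag, Rabs_R0).
  set (k := g (x + h) - g x).
  assert (Hk : k <> 0).
  { intros Hk. apply Hh. assert (Hgx : g (x + h) = g x) by (unfold k in Hk; lra).
    rewrite Hgx, E0 in E1. lra. }
  assert (Hkd : Rabs k < d1).
  { apply Hgc. split; [split; [exact I | lra]|]. simpl. unfold Rdist.
    now replace (x + h - x) with h by ring. }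
  specialize (Hd1 k Hk Hkd). unfold k in Hd1 at 1.
  replace (g x + (g (x + h) - g x)) with (g (x + h)) in Hd1 by ring.
  rewrite E1, E0 in Hd1. replace (x + h - x) with h in Hd1 by ring.
  set (r := h / k) in Hd1.
  assert (Hr : r <> 0) by (unfold r; now apply Rmult_integral_contrapositive_currified, Rinv_neq_0_compat).
  replace (k / h) with (/ r) by (unfold r; field; auto).
  assert (Hr1 := Rlt_le_trans _ _ _ Hd1 (Rmin_l _ _)).
  assert (Hr2 := Rlt_le_trans _ _ _ Hd1 (Rmin_r _ _)).
  assert (Hrl : Rabs l / 2 < Rabs r).
  { pose proof (Rabs_triang_inv l (l - r)) as Ht. replace (l - (l - r)) with r in Ht by ring.
    rewrite (Rabs_minus_sym l r) in Ht. lra. }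
  replace (/ r - / l) with (- ((r - l) / (r * l))) by (field; auto).
  rewrite Rabs_Ropp. unfold Rdiv. rewrite Rabs_mult, Rabs_inv, Rabs_mult.
  apply (Rmult_lt_reg_r (Rabs r * Rabs l)); [nra|].
  rewrite Rmult_assoc, Rinv_l by nra.
  assert (eps * (Rabs l / 2 * Rabs l) < eps * (Rabs r * Rabs l)).
  { apply Rmult_lt_compat_l; [exact Heps|]. now apply Rmult_lt_compat_r. }
  assert (0 < eps * Rabs l ^ 2) by (apply Rmult_lt_0_compat; [exact Heps | now apply pow_lt]).
  lra.
Qed.

(** From |2 w w'| <= 2 M w^2 + M (w^2 + 1) <= 3 M (w^2 + 1), the product (w^2 + 1) exp (3 M t) does
    not decrease. Solutions with a zero in [0, T] thus start in a bounded set, and all others keep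
    their sign. *)
Lemma solution_zero_bound (a b w : R -> R) (M T tau : R) :
  (forall t, Rabs (a t) <= M) -> (forall t, Rabs (b t) <= M) ->
  (forall t, is_derive w t (a t * Rabs (w t) + b t)) ->
  0 <= tau <= T -> w tau = 0 -> w 0 ^ 2 + 1 <= exp (3 * M * T).
Proof.
  intros Ha Hb Hw Htau H0.
  assert (HM : 0 <= M) by (eapply Rle_trans; [apply Rabs_pos | apply (Ha 0)]).
  assert (H : (w 0 ^ 2 + 1) * exp (3 * M * 0) <= (w tau ^ 2 + 1) * exp (3 * M * tau)).
  { apply (derive_nonneg_le (fun t => (w t ^ 2 + 1) * exp (3 * M * t))
      (fun t => (2 * w t * (a t * Rabs (w t) + b t) + 3 * M * (w t ^ 2 + 1)) * exp (3 * M * t)));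
      [lra| |].
    - intros t _. auto_derive; [eexists; apply Hw|].
      replace (Derive (fun x => w x) t) with (a t * Rabs (w t) + b t)
        by (symmetry; apply is_derive_unique, Hw). ring.
    - intros t _. apply Rmult_le_pos; [|left; apply exp_pos].
      specialize (Ha t). specialize (Hb t).
      apply Rabs_le_between in Ha. apply Rabs_le_between in Hb.
      assert (H1 : Rabs (a t * Rabs (w t) * w t) <= M * w t ^ 2).
      { rewrite !Rabs_mult, Rabs_Rabsolu, <- pow2_abs. simpl. rewrite Rmult_1_r, Rmult_assoc.
        apply Rmult_le_compat_r; [pose proof (Rabs_pos (w t)); nra | now apply Rabs_le]. }
      assert (H2 : Rabs (2 * (b t * w t)) <= M * (w t ^ 2 + 1)).
      { rewrite !Rabs_mult, (Rabs_pos_eq 2) by lra.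
        assert (Rabs (b t) <= M) by now apply Rabs_le.
        rewrite <- (pow2_abs (w t)). pose proof (Rabs_pos (w t)). pose proof (Rabs_pos (b t)).
        assert (Rabs (b t) * Rabs (w t) <= M * Rabs (w t)) by now apply Rmult_le_compat_r.
        pose proof (pow2_ge_0 (Rabs (w t) - 1)). nra. }
      apply Rabs_le_between in H1. apply Rabs_le_between in H2. nra. }
  rewrite H0, Rmult_0_r, exp_0 in H.
  assert (exp (3 * M * tau) <= exp (3 * M * T)).
  { destruct (Req_dec (3 * M * tau) (3 * M * T)) as [-> | Hne]; [lra|].
    left. apply exp_increasing. assert (3 * M * tau <= 3 * M * T) by nra. lra. }
  lra.
Qed.

(** * The linear equations on the two half planes *)

(** The variation-of-constants integral of u' = e a u + b, when A is a primitive of a. *)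
Definition weighted_int (A b : R -> R) (e t : R) : R :=
  RInt (fun s => b s * exp (- (e * A s))) 0 t.

Lemma weighted_int_derive (A b : R -> R) (e : R) :
  (forall t, continuous A t) -> (forall t, continuous b t) ->
  forall t, is_derive (weighted_int A b e) t (b t * exp (- (e * A t))).
Proof.
  intros HA Hb t.
  assert (Hc : forall s, continuous (fun s => b s * exp (- (e * A s))) s).
  { intros s. apply (continuous_mult (K := R_AbsRing)); [apply Hb|].
    apply (continuous_comp (fun s => - (e * A s)) exp).
    - apply (continuous_opp (V := R_NormedModule)), (continuous_scal_r (V := R_NormedModule)), HA.
    - apply (ex_derive_continuous (V := R_NormedModule)). auto_derive; auto. }
  apply (is_derive_RInt (V := R_CompleteNormedModule) (fun s => b s * exp (- (e * A s))) _ 0).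
  - exists (mkposreal 1 Rlt_0_1). intros s _.
    apply (RInt_correct (V := R_CompleteNormedModule)), ex_RInt_continuous. intros r _. apply Hc.
  - apply Hc.
Qed.

Lemma weighted_int_0 (A b : R -> R) (e : R) : weighted_int A b e 0 = 0.
Proof. apply (RInt_point (V := R_CompleteNormedModule)). Qed.

(* Where e u >= 0, with e = 1 or e = -1, the equation is the linear equation u' = e a u + b. *)
Lemma half_line_solution (a b A w : R -> R) (e p q : R) :
  e * e = 1 -> p <= q -> (forall t, continuous b t) ->
  (forall t, is_derive A t (a t)) ->
  (forall t, is_derive w t (a t * Rabs (w t) + b t)) ->
  (forall t, p <= t <= q -> 0 <= e * w t) ->
  w p * exp (- (e * A p)) - weighted_int A b e p = w q * exp (- (e * A q)) - weighted_int A b e q.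
Proof.
  intros He Hpq Hb HA Hw Hsign.
  apply (derive_zero_eq (fun t => w t * exp (- (e * A t)) - weighted_int A b e t)); [exact Hpq|].
  intros t Ht.
  assert (Habs : Rabs (w t) = e * w t).
  { specialize (Hsign t Ht). rewrite <- (Rabs_pos_eq _ Hsign), Rabs_mult.
    replace (Rabs e) with 1; [ring|]. assert (Hcase : (e - 1) * (e + 1) = 0) by lra.
    apply Rmult_integral in Hcase. destruct Hcase; unfold Rabs; destruct Rcase_abs; lra. }
  replace 0 with ((w t * (- (e * a t) * exp (- (e * A t)))
    + (a t * Rabs (w t) + b t) * exp (- (e * A t))) - b t * exp (- (e * A t)))
    by (rewrite Habs; ring).
  apply (is_derive_minus (V := R_NormedModule)).
  - auto_derive.
    + repeat split; eexists; eauto.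
    + replace (Derive (fun x => A x) t) with (a t) by (symmetry; apply is_derive_unique, HA).
      replace (Derive (fun x => w x) t) with (a t * Rabs (w t) + b t)
        by (symmetry; apply is_derive_unique, Hw). ring.
  - apply weighted_int_derive; [|exact Hb].
    intros s. apply (ex_derive_continuous (V := R_NormedModule)). eexists. apply HA.
Qed.

(** * Consequences of a global center *)

Section Center.
Variables (a b : R -> R) (u : R -> R -> R).
Hypotheses (Ha : trig_poly a) (Hb : trig_poly b).
Hypothesis Hu : is_solution_map a b u.
Hypothesis Hcenter : global_center u.

Lemma solution_continuity (x : R) : continuity (fun t => u t x).
Proof. intros t. apply (is_derive_continuity_pt _ _ _ (proj2 (Hu x) t)). Qed.

Lemma large_solutions : exists X, 0 < X /\ forall e x, e * e = 1 -> X < e * x ->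
  forall t, 0 <= t <= 2 * PI -> 0 < e * u t x.
Proof.
  destruct (trig_poly_bounded a Ha) as [M [HM HaM]].
  destruct (trig_poly_bounded b Hb) as [N [HN HbN]].
  set (X := exp (3 * (M + N) * (2 * PI))).
  assert (HX : 0 < X) by apply exp_pos.
  exists (X + 1). split; [lra|]. intros e x He Hx t Ht.
  assert (H0 : u 0 x = x) by apply Hu.
  apply (no_zero_sign (fun t => e * u t x) 0 (2 * PI) 0); try (pose proof PI_RGT_0; lra).
  - apply continuity_scal, solution_continuity.
  - intros r Hr Hz. assert (Hz' : u r x = 0).
    { replace (u r x) with (e * (e * u r x)); [rewrite Hz; ring|].
      rewrite <- Rmult_assoc, He. ring. }
    pose proof (solution_zero_bound a b (fun t => u t x) (M + N) (2 * PI) r) as H.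
    simpl in H. rewrite H0 in H.
    assert (Hx2 : x * x = (e * x) * (e * x)).
    { replace (e * x * (e * x)) with ((e * e) * (x * x)) by ring. rewrite He. ring. }
    specialize (H ltac:(intros s; specialize (HaM s); lra)
                  ltac:(intros s; specialize (HbN s); lra) (proj2 (Hu x)) Hr Hz').
    fold X in H. rewrite Rmult_1_r, Hx2 in H. nra.
  - rewrite H0. lra.
Qed.

(** For large |x| of sign e the return map is affine in x. As it fixes two such x, its slope is 1,
    which gives A(2 pi) = 0, and its intercept is 0, which gives the vanishing weighted integral for
    that e. *)
Lemma center_primitive : exists A, trig_poly A /\ (forall t, is_derive A t (a t)) /\
  A 0 = 0 /\ weighted_int A b 1 (2 * PI) = 0 /\ weighted_int A b (-1) (2 * PI) = 0.
Proof.
  pose proof PI_RGT_0 as Hpi.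
  destruct (trig_poly_primitive a Ha) as [F [c [HF HF']]].
  set (A := fun t => F t + (c * t - F 0)).
  assert (HA : forall t, is_derive A t (a t)).
  { intros t. unfold A. replace (a t) with ((a t - c) + c) by ring.
    apply (is_derive_plus (V := R_NormedModule)); [apply HF'|]. auto_derive; [exact I | ring]. }
  assert (HA0 : A 0 = 0) by (unfold A; ring).
  assert (HA2 : A (2 * PI) = c * (2 * PI)) by (unfold A; rewrite (trig_poly_2PI F HF); ring).
  destruct large_solutions as [X [HX Hlarge]].
  assert (Hlin : forall e x, e * e = 1 -> X < e * x ->
    x = x * exp (- (e * A (2 * PI))) - weighted_int A b e (2 * PI)).
  { intros e x He Hx.
    pose proof (half_line_solution a b A (fun t => u t x) e 0 (2 * PI) He ltac:(lra)
      (trig_poly_continuous b Hb) HA (proj2 (Hu x))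
      ltac:(intros t Ht; left; now apply Hlarge)) as H. simpl in H.
    rewrite (Hcenter x), (proj1 (Hu x)), HA0, weighted_int_0, Rmult_0_r, Ropp_0, exp_0 in H.
    lra. }
  assert (Hc : A (2 * PI) = 0).
  { pose proof (Hlin 1 (X + 1) ltac:(ring) ltac:(lra)) as H1.
    pose proof (Hlin 1 (X + 2) ltac:(ring) ltac:(lra)) as H2.
    assert (H : exp (- (1 * A (2 * PI))) = exp 0) by (rewrite exp_0; lra).
    apply exp_inv in H. lra. }
  assert (Hc0 : c = 0) by (rewrite HA2 in Hc; nra).
  exists A. split; [|split; [exact HA|split; [exact HA0|split]]].
  - apply (trig_poly_ext (fun t => F t + - F 0)); [intros t; unfold A; rewrite Hc0; ring|].
    apply trig_poly_plus; [exact HF | apply trig_poly_const].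
  - pose proof (Hlin 1 (X + 1) ltac:(ring) ltac:(lra)) as H.
    rewrite Hc, Rmult_0_r, Ropp_0, exp_0 in H. lra.
  - pose proof (Hlin (-1) (- (X + 1)) ltac:(ring) ltac:(lra)) as H.
    rewrite Hc, Rmult_0_r, Ropp_0, exp_0 in H. lra.
Qed.

(** * The two zeros as functions of the initial value *)

Section Zeros.
Variables (A : R -> R) (x1 x2 : R) (t1 t2 : R -> R).
Hypothesis HA : forall t, is_derive A t (a t).
Hypothesis A_0 : A 0 = 0.
Hypothesis A_2PI : A (2 * PI) = 0.
Hypothesis Eplus : weighted_int A b 1 (2 * PI) = 0.
Hypothesis Eminus : weighted_int A b (-1) (2 * PI) = 0.
Hypothesis Hzeros : forall x : R, x1 < x < x2 ->
  0 < t1 x /\ t1 x < t2 x /\ t2 x < 2 * PI /\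
  u (t1 x) x = 0 /\ u (t2 x) x = 0 /\
  (forall t : R, 0 < t < 2 * PI -> u t x = 0 -> t = t1 x \/ t = t2 x) /\
  Derive (fun s => u s x) (t1 x) <> 0 /\
  Derive (fun s => u s x) (t2 x) <> 0.

Lemma derive_at_zero (t x : R) : u t x = 0 -> is_derive (fun s => u s x) t (b t).
Proof.
  intros H. pose proof (proj2 (Hu x) t) as Hd. rewrite H, Rabs_R0, Rmult_0_r, Rplus_0_l in Hd.
  exact Hd.
Qed.

Lemma b_at_zeros (x : R) : x1 < x < x2 -> b (t1 x) <> 0 /\ b (t2 x) <> 0.
Proof.
  intros Hx. destruct (Hzeros x Hx) as (_ & _ & _ & H1 & H2 & _ & D1 & D2).
  split; intros H; [apply D1 | apply D2]; rewrite <- H;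
    now apply is_derive_unique, derive_at_zero.
Qed.

(** With e the sign of x, the solution has sign e before t1 and after t2, since it starts and ends
    at x, and sign -e between them, since the zero at t1 is simple. Each of the three arcs obeys a
    linear equation; the last one uses A(2 pi) = 0 and the vanishing weighted integral. *)
Lemma weighted_int_zeros (e x : R) : x1 < x < x2 -> e = 1 \/ e = -1 -> 0 < e * x ->
  weighted_int A b e (t1 x) = - x /\ weighted_int A b e (t2 x) = - x /\
  weighted_int A b (- e) (t1 x) = weighted_int A b (- e) (t2 x).
Proof.
  intros Hx He Hex.
  destruct (Hzeros x Hx) as (P1 & P12 & P2 & U1 & U2 & Uniq & _ & _).
  destruct (b_at_zeros x Hx) as [B1 _].
  assert (He2 : e * e = 1) by (destruct He as [-> | ->]; ring).
  assert (HE : weighted_int A b e (2 * PI) = 0) by (destruct He as [-> | ->]; assumption).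
  set (v := fun t => e * u t x).
  assert (Hv0 : v 0 = e * x) by (unfold v; now rewrite (proj1 (Hu x))).
  assert (Hv2 : v (2 * PI) = e * x) by (unfold v; now rewrite Hcenter, (proj1 (Hu x))).
  assert (Hv : continuity v) by apply continuity_scal, solution_continuity.
  assert (Hnz : forall t, 0 <= t <= 2 * PI -> t <> t1 x -> t <> t2 x -> v t <> 0).
  { intros t Ht N1 N2 Hz.
    destruct (Req_dec t 0) as [-> | Ht0]; [lra|].
    destruct (Req_dec t (2 * PI)) as [-> | Ht2]; [lra|].
    destruct (Uniq t) as [|]; try contradiction; [lra|].
    unfold v in Hz. apply Rmult_integral in Hz. destruct Hz as [Hz|]; [|assumption].
    rewrite Hz in He2. lra. }
  assert (Hv1z : v (t1 x) = 0) by (unfold v; rewrite U1; ring).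
  assert (Hv2z : v (t2 x) = 0) by (unfold v; rewrite U2; ring).
  assert (Hleft : forall t, 0 <= t < t1 x -> 0 < v t).
  { intros t Ht. apply (no_zero_sign v 0 t 0 t Hv); try lra.
    intros r Hr. apply Hnz; lra. }
  assert (Hright : forall t, t2 x < t <= 2 * PI -> 0 < v t).
  { intros t Ht. apply (no_zero_sign v t (2 * PI) (2 * PI) t Hv); try lra.
    intros r Hr. apply Hnz; lra. }
  (* v is positive left of t1 and has a nonzero derivative there, hence a negative one; it is
     negative just right of t1 and stays so until t2. *)
  assert (Hmid : forall t, t1 x < t < t2 x -> v t < 0).
  { assert (Hdv : is_derive v (t1 x) (e * b (t1 x))).
    { apply is_derive_scal, derive_at_zero, U1. }
    destruct (simple_zero_sign v (t1 x) (e * b (t1 x)) Hdv Hv1z) as [d [Hd Hs]].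
    { apply Rmult_integral_contrapositive_currified; [|exact B1]. intros H. rewrite H in He2. lra. }
    set (h := Rmin (Rmin d (t1 x)) (t2 x - t1 x) / 2).
    assert (Hh : 0 < h /\ h < d /\ h < t1 x /\ h < t2 x - t1 x).
    { unfold h, Rmin. repeat destruct Rle_dec; lra. }
    pose proof (Hs h ltac:(lra) ltac:(rewrite Rabs_pos_eq; lra)) as S1.
    pose proof (Hs (- h) ltac:(lra) ltac:(rewrite Rabs_Ropp, Rabs_pos_eq; lra)) as S2.
    pose proof (Hleft (t1 x + - h) ltac:(lra)) as S3.
    assert (Hl : e * b (t1 x) < 0).
    { apply Rnot_le_lt; intros Hl.
      assert (0 <= e * b (t1 x) * h * v (t1 x + - h))
        by (apply Rmult_le_pos; [apply Rmult_le_pos|]; lra). lra. }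
    assert (S4 : v (t1 x + h) < 0).
    { apply Rnot_le_lt; intros Hl'.
      assert (0 <= - (e * b (t1 x)) * h * v (t1 x + h))
        by (apply Rmult_le_pos; [apply Rmult_le_pos|]; lra). lra. }
    intros t Ht. apply Ropp_lt_cancel. rewrite Ropp_0.
    apply (no_zero_sign (fun s => - v s) (Rmin t (t1 x + h)) (Rmax t (t1 x + h)) (t1 x + h) t).
    - now apply continuity_opp.
    - intros r Hr Hz. apply (Hnz r); try lra;
        revert Hr; unfold Rmin, Rmax; repeat destruct Rle_dec; lra.
    - split; [apply Rmin_r | apply Rmax_r].
    - split; [apply Rmin_l | apply Rmax_l].
    - lra. }
  assert (Hbc := trig_poly_continuous b Hb).
  pose proof (half_line_solution a b A (fun t => u t x) e 0 (t1 x) He2 ltac:(lra) Hbc HA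
    (proj2 (Hu x))) as L1.
  pose proof (half_line_solution a b A (fun t => u t x) (- e) (t1 x) (t2 x) ltac:(lra) ltac:(lra)
    Hbc HA (proj2 (Hu x))) as L2.
  pose proof (half_line_solution a b A (fun t => u t x) e (t2 x) (2 * PI) He2 ltac:(lra) Hbc HA
    (proj2 (Hu x))) as L3.
  simpl in L1, L2, L3.
  rewrite U1, (proj1 (Hu x)), A_0, weighted_int_0, Rmult_0_r, Ropp_0, exp_0 in L1.
  rewrite U1, U2 in L2.
  rewrite U2, Hcenter, (proj1 (Hu x)), A_2PI, HE, Rmult_0_r, Ropp_0, exp_0 in L3.
  split; [|split].
  - lapply L1; [lra|]. intros t Ht. destruct (Req_dec t (t1 x)) as [-> | Hne].
    + unfold v in Hv1z. lra.
    + left. apply Hleft. lra.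
  - lapply L3; [lra|]. intros t Ht. destruct (Req_dec t (t2 x)) as [-> | Hne].
    + unfold v in Hv2z. lra.
    + left. apply Hright. lra.
  - lapply L2; [lra|]. intros t Ht. fold (v t).
    destruct (Req_dec t (t1 x)) as [-> | Hne1]; [unfold v in Hv1z; lra|].
    destruct (Req_dec t (t2 x)) as [-> | Hne2]; [unfold v in Hv2z; lra|].
    pose proof (Hmid t ltac:(lra)). unfold v in *. lra.
Qed.

Lemma zeros_continuous (x : R) : x1 < x < x2 -> continuity_pt t1 x /\ continuity_pt t2 x.
Proof.
  intros Hx. destruct (Hzeros x Hx) as (P1 & P12 & P2 & U1 & U2 & _ & _ & _).
  destruct (b_at_zeros x Hx) as [B1 B2].
  destruct (trig_poly_bounded a Ha) as [M [HM HaM]].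
  assert (Hboth : forall eps, 0 < eps -> exists d, 0 < d /\
    forall y, Rabs (y - x) < d -> Rabs (t1 y - t1 x) < eps /\ Rabs (t2 y - t2 x) < eps).
  { intros eps Heps.
    (* This radius keeps the neighbourhoods of t1 x and t2 x inside (0, 2 pi) and disjoint, so that
       the zeros of a nearby solution found in them are t1 y and t2 y in this order. *)
    set (r := Rmin (Rmin eps (t1 x)) (Rmin ((t2 x - t1 x) / 2) (2 * PI - t2 x))).
    assert (Hr : 0 < r /\ r <= eps /\ r <= t1 x /\ r <= (t2 x - t1 x) / 2 /\ r <= 2 * PI - t2 x).
    { unfold r, Rmin. repeat destruct Rle_dec; lra. }
    destruct (simple_zero_persists _ _ _ r (derive_at_zero _ _ U1) U1 B1 ltac:(lra))
      as (e1 & m1 & He1 & Hm1 & Hz1).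
    destruct (simple_zero_persists _ _ _ r (derive_at_zero _ _ U2) U2 B2 ltac:(lra))
      as (e2 & m2 & He2 & Hm2 & Hz2).
    set (L := exp (M * (2 * PI))). assert (HL : 0 < L) by apply exp_pos.
    set (d := Rmin (Rmin (m1 / L) (m2 / L)) (Rmin (x - x1) (x2 - x))).
    assert (Hd : 0 < d /\ d <= m1 / L /\ d <= m2 / L /\ d <= x - x1 /\ d <= x2 - x).
    { pose proof (Rdiv_lt_0_compat _ _ Hm1 HL). pose proof (Rdiv_lt_0_compat _ _ Hm2 HL).
      unfold d, Rmin. repeat destruct Rle_dec; lra. }
    exists d. split; [lra|]. intros y Hy.
    assert (Hyx : x1 < y < x2) by (apply Rabs_lt_between in Hy; lra).
    assert (Hclose : forall t, 0 <= t <= 2 * PI ->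
      Rabs (u t y - u t x) < m1 /\ Rabs (u t y - u t x) < m2).
    { intros t Ht.
      pose proof (solution_dependence a b (fun t => u t y) (fun t => u t x) M HaM
        (proj2 (Hu y)) (proj2 (Hu x)) t ltac:(lra)) as H. simpl in H.
      rewrite (proj1 (Hu x)), (proj1 (Hu y)) in H.
      assert (Hexp : exp (M * t) <= L).
      { unfold L. destruct (Req_dec t (2 * PI)) as [-> | Hne]; [lra|].
        left. apply exp_increasing. apply Rmult_lt_compat_l; lra. }
      assert (Hle : Rabs (u t y - u t x) <= Rabs (y - x) * L).
      { eapply Rle_trans; [exact H|]. apply Rmult_le_compat_l; [apply Rabs_pos | exact Hexp]. }
      assert (E1 : m1 = m1 / L * L) by (field; lra).
      assert (E2 : m2 = m2 / L * L) by (field; lra).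
      assert (Rabs (y - x) * L < m1 / L * L) by (apply Rmult_lt_compat_r; lra).
      assert (Rabs (y - x) * L < m2 / L * L) by (apply Rmult_lt_compat_r; lra).
      lra. }
    destruct (Hz1 (fun t => u t y) (solution_continuity y)) as [z1 [Hz1I Hz10]];
      try (apply Hclose; lra).
    destruct (Hz2 (fun t => u t y) (solution_continuity y)) as [z2 [Hz2I Hz20]];
      try (apply Hclose; lra).
    destruct (Hzeros y Hyx) as (_ & Q12 & _ & _ & _ & Uniq & _ & _).
    destruct (Uniq z1 ltac:(lra) Hz10) as [-> | ->], (Uniq z2 ltac:(lra) Hz20) as [-> | ->];
      try lra.
    split; apply Rabs_lt_between; lra. }
  split; intros eps Heps; destruct (Hboth eps Heps) as [d [Hd H]]; exists d;
    (split; [exact Hd|]); intros y [_ Hy]; now apply H.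
Qed.

(** By [weighted_int_zeros], t1 and t2 are local right inverses of the same function, minus the
    weighted integral for e; continuity of the zeros lets [inverse_derive] apply. *)
Lemma zeros_derive (e x : R) : x1 < x < x2 -> e = 1 \/ e = -1 -> 0 < e * x ->
  is_derive t1 x (- / (b (t1 x) * exp (- (e * A (t1 x))))) /\
  is_derive t2 x (- / (b (t2 x) * exp (- (e * A (t2 x))))).
Proof.
  intros Hx He Hex. destruct (zeros_continuous x Hx) as [C1 C2].
  destruct (b_at_zeros x Hx) as [B1 B2].
  assert (Hnear : exists d, 0 < d /\
    forall y, Rabs (y - x) < d -> x1 < y < x2 /\ 0 < e * y).
  { set (d := Rmin (Rmin (x - x1) (x2 - x)) (e * x)).
    assert (Hd : 0 < d /\ d <= x - x1 /\ d <= x2 - x /\ d <= e * x).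
    { unfold d, Rmin. repeat destruct Rle_dec; lra. }
    exists d. split; [lra|]. intros y Hy. apply Rabs_lt_between in Hy.
    destruct He as [-> | ->]; lra. }
  destruct Hnear as [d [Hd Hnear]].
  assert (HAc : forall t, continuous A t).
  { intros s. apply (ex_derive_continuous (V := R_NormedModule)). eexists. apply HA. }
  assert (Hder : forall t, is_derive (fun s => - weighted_int A b e s) t
    (- (b t * exp (- (e * A t))))).
  { intros t. apply (is_derive_opp (V := R_NormedModule)).
    apply weighted_int_derive; [exact HAc | now apply trig_poly_continuous]. }
  rewrite <- !Rinv_opp.
  assert (Hexp : forall t, exp t <> 0) by (intros t; pose proof (exp_pos t); lra).
  split; apply (inverse_derive (fun s => - weighted_int A b e s)); auto;
    try (apply Ropp_neq_0_compat, Rmult_integral_contrapositive_currified; auto);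
    exists d; (split; [exact Hd|]); intros y Hy; destruct (Hnear y Hy) as [Hy1 Hy2];
    destruct (weighted_int_zeros e y Hy1 He Hy2) as (E1 & E2 & _); rewrite ?E1, ?E2; ring.
Qed.

(** Differentiate F(t1(y)) = F(t2(y)) at x and clear the denominators of t1' and t2'. It is applied
    first to the weighted integral for -e, then to A. *)
Lemma zeros_near (F f : R -> R) (e x : R) : x1 < x < x2 -> e = 1 \/ e = -1 -> 0 < e * x ->
  (forall t, is_derive F t (f t)) ->
  (forall y, x1 < y < x2 -> 0 < e * y -> F (t1 y) = F (t2 y)) ->
  f (t1 x) * (b (t2 x) * exp (- (e * A (t2 x)))) =
  f (t2 x) * (b (t1 x) * exp (- (e * A (t1 x)))).
Proof.
  intros Hx He Hex HF Heq. destruct (zeros_derive e x Hx He Hex) as [D1 D2].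
  destruct (b_at_zeros x Hx) as [B1 B2].
  pose proof (is_derive_comp F t1 x _ _ (HF (t1 x)) D1) as C1.
  pose proof (is_derive_comp F t2 x _ _ (HF (t2 x)) D2) as C2.
  assert (C1' : is_derive (fun y => F (t2 y)) x
     (scal (- / (b (t1 x) * exp (- (e * A (t1 x))))) (f (t1 x)))).
  { apply (is_derive_ext_loc (fun y => F (t1 y))); [|exact C1].
    set (d := Rmin (Rmin (x - x1) (x2 - x)) (e * x)).
    assert (Hd : 0 < d /\ d <= x - x1 /\ d <= x2 - x /\ d <= e * x).
    { unfold d, Rmin. repeat destruct Rle_dec; lra. }
    exists (mkposreal d (proj1 Hd)). intros y Hy.
    assert (Hy' : Rabs (y - x) < d) by exact Hy.
    apply Rabs_lt_between in Hy'. apply Heq; [lra|]. destruct He as [-> | ->]; lra. }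
  apply is_derive_unique in C1'. apply is_derive_unique in C2. rewrite C2 in C1'.
  unfold scal in C1'; simpl in C1'; unfold mult in C1'; simpl in C1'.
  pose proof (exp_pos (- (e * A (t1 x)))). pose proof (exp_pos (- (e * A (t2 x)))).
  clear C1 C2 D1 D2. revert C1' H H0.
  generalize (exp (- (e * A (t1 x)))) (exp (- (e * A (t2 x)))). intros e1 e2 C He1 He2.
  assert (C' : f (t2 x) / (b (t2 x) * e2) = f (t1 x) / (b (t1 x) * e1)).
  { unfold Rdiv. rewrite !Rinv_mult in *. lra. }
  apply (f_equal (fun r => r * (b (t1 x) * e1) * (b (t2 x) * e2))) in C'.
  field_simplify in C'; [|repeat split; lra..]. lra.
Qed.

(** The weighted integral for -e has derivative b exp (e A); after cancelling b(t1) b(t2),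
    [zeros_near] leaves exp (e (A(t1) - A(t2))) = exp (e (A(t2) - A(t1))), whence A(t1) = A(t2).
    Then [zeros_near] for A carries equal exponential weights on both sides. *)
Lemma zeros_identities (x : R) : x1 < x < x2 -> x <> 0 ->
  A (t1 x) = A (t2 x) /\ a (t1 x) * b (t2 x) = a (t2 x) * b (t1 x).
Proof.
  assert (HAc : forall t, continuous A t).
  { intros s. apply (ex_derive_continuous (V := R_NormedModule)). eexists. apply HA. }
  assert (HeqA : forall e y, x1 < y < x2 -> e = 1 \/ e = -1 -> 0 < e * y -> A (t1 y) = A (t2 y)).
  { intros e y Hy He Hey. destruct (b_at_zeros y Hy) as [B1 B2].
    pose proof (zeros_near (weighted_int A b (- e)) _ e y Hy He Hey
      (weighted_int_derive A b (- e) HAc (trig_poly_continuous b Hb))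
      ltac:(intros z Hz Hez; apply (weighted_int_zeros e z Hz He Hez))) as H.
    simpl in H.
    assert (H' : (b (t1 y) * b (t2 y)) * exp (- (- e * A (t1 y)) + - (e * A (t2 y)))
               = (b (t1 y) * b (t2 y)) * exp (- (- e * A (t2 y)) + - (e * A (t1 y))))
      by (rewrite !exp_plus; lra).
    apply Rmult_eq_reg_l in H'; [|now apply Rmult_integral_contrapositive_currified].
    apply exp_inv in H'. destruct He as [-> | ->]; lra. }
  intros Hx Hx0.
  assert (Hsign : exists e, (e = 1 \/ e = -1) /\ 0 < e * x).
  { destruct (Rlt_dec 0 x); [exists 1 | exists (-1)]; split; auto; lra. }
  destruct Hsign as [e [He Hex]]. assert (HAx := HeqA e x Hx He Hex). split; [exact HAx|].
  pose proof (zeros_near A a e x Hx He Hex HA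
    (fun y Hy Hey => HeqA e y Hy He Hey)) as H.
  rewrite HAx in H. pose proof (exp_pos (- (e * A (t2 x)))).
  apply (Rmult_eq_reg_r (exp (- (e * A (t2 x))))); lra.
Qed.

(** Either zero determines x, as minus the weighted integral up to it; the common sign makes it the
    same integral for both initial values. *)
Lemma zeros_injective (x y : R) : x1 < x < x2 -> x1 < y < x2 -> 0 < x * y ->
  t1 x = t1 y \/ t2 x = t2 y -> x = y.
Proof.
  intros Hx Hy Hxy Heq.
  assert (Hsign : exists e, (e = 1 \/ e = -1) /\ 0 < e * x /\ 0 < e * y).
  { destruct (Rlt_dec 0 x); [exists 1 | exists (-1)]; (split; [auto|]; split; [nra|nra]). }
  destruct Hsign as [e [He [Hex Hey]]].
  destruct (weighted_int_zeros e x Hx He Hex) as (E1 & E2 & _).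
  destruct (weighted_int_zeros e y Hy He Hey) as (F1 & F2 & _).
  destruct Heq as [Heq | Heq]; rewrite Heq in *; lra.
Qed.
End Zeros.
End Center.

Lemma cos_neq1 (t : R) : 0 < t < 2 * PI -> cos t <> 1.
Proof.
  intros Ht Hc. replace t with (2 * (t / 2)) in Hc by field.
  rewrite cos_2a_sin in Hc. pose proof (sin_gt_0 (t / 2) ltac:(lra) ltac:(lra)). nra.
Qed.

(** * Fractions invariant under a sequence of pairs of points *)

Module InvariantFractions.
Import all_boot all_order all_algebra ring zify.
Import GRing.Theory Num.Theory.
Set Implicit Arguments. Unset Strict Implicit. Unset Printing Implicit Defensive.
Local Open Scope ring_scope.

Lemma classical_argmin (X : Type) (P : X -> Prop) (f : X -> nat) :
  (exists x, P x) -> exists2 x, P x & forall y, P y -> (f x <= f y)%N.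
Proof.
move=> [x Px]; move: {2}(f x) (leqnn (f x)) => n; elim: n x Px => [|n IHn] x Px le_fx.
  by exists x => // y _; apply: leq_trans le_fx _.
case: (classic (exists2 y, P y & (f y < f x)%N)) => [[y Py lt_yx]|no_y].
  by apply: (IHn y Py); rewrite -ltnS (leq_trans lt_yx).
exists x => // y Py; rewrite leqNgt; apply/negP => lt_yx; apply: no_y.
by exists y.
Qed.

(** * Invariance as a relation between numerators and denominators *)

Section Invariants.
Variables (C : numClosedFieldType) (z w : nat -> C).
Hypothesis generic : forall p : {poly C}, p != 0 ->
  exists K, forall k, (K <= k)%N -> p.[z k] != 0 /\ p.[w k] != 0.

Implicit Types (p q r g h F D : {poly C}) (M V Q : {poly {poly C}}).

(** The fraction p / q takes equal values at [z k] and [w k] for all large k, with denominators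
    cleared. The threshold lets [generic] discard the finitely many k at which a cancelled factor
    vanishes. *)
Definition inv p q := exists K, forall k, (K <= k)%N ->
  p.[z k] * q.[w k] = p.[w k] * q.[z k].

Lemma inv_refl p : inv p p.
Proof. by exists 0%N => k _; rewrite mulrC. Qed.

Lemma inv_sym p q : inv p q -> inv q p.
Proof.
by move=> [K H]; exists K => k /H; rewrite mulrC [RHS]mulrC => ->.
Qed.

Lemma inv0 q : inv 0 q.
Proof. by exists 0%N => k _; rewrite !horner0 !mul0r. Qed.

Lemma invD p p' q : inv p q -> inv p' q -> inv (p + p') q.
Proof.
move=> [K H] [K' H']; exists (maxn K K') => k; rewrite geq_max => /andP[le1 le2].
by rewrite !hornerD !mulrDl H // H'.
Qed.

Lemma invZ c p q : inv p q -> inv (c *: p) q.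
Proof. by move=> [K H]; exists K => k /H eq_k; rewrite !hornerZ -!mulrA eq_k. Qed.

Lemma invB p p' q : inv p q -> inv p' q -> inv (p - p') q.
Proof. by move=> Hp Hp'; rewrite -scaleN1r; apply: invD => //; apply: invZ. Qed.

Lemma invM p p' q q' : inv p q -> inv p' q' -> inv (p * p') (q * q').
Proof.
move=> [K H] [K' H']; exists (maxn K K') => k; rewrite geq_max => /andP[le1 le2].
by rewrite !hornerM mulrACA H // H' // mulrACA.
Qed.

Lemma inv_cancel c p q : c != 0 -> inv (p * c) (q * c) -> inv p q.
Proof.
move=> /generic[K nz_c] [K' H']; exists (maxn K K') => k.
rewrite geq_max => /andP[/nz_c[cz cw] /H']; rewrite !hornerM mulrACA [RHS]mulrACA.
by rewrite [c.[w k] * _]mulrC => /mulIf -> //; apply: mulf_neq0.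
Qed.

Lemma inv_trans q p r : q != 0 -> inv p q -> inv q r -> inv p r.
Proof.
move=> nz_q Hpq Hqr; apply: (inv_cancel nz_q); rewrite [r * q]mulrC.
exact: invM.
Qed.

Lemma invMr c p q : inv p q -> inv (p * c) (q * c).
Proof. by move=> Hpq; apply: invM => //; apply: inv_refl. Qed.

(* [crossp p q] is p(w) q(z) - p(z) q(w), read as a polynomial in w whose
   coefficients are polynomials in z. *)
Definition crossp p q : {poly {poly C}} := q *: p^:P - p *: q^:P.

(** V / q is a polynomial in w whose coefficients are invariant fractions. *)
Definition typed q V := forall i, inv V`_i q.

Lemma horner_lift p r : (p^:P).[r] = p \Po r.
Proof. by []. Qed.

Lemma horner_lift_polyC p c : (p^:P).[c%:P] = p.[c]%:P.
Proof. by rewrite horner_lift comp_polyCr. Qed.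

Lemma crossp_diag p q : (crossp p q).['X] = 0.
Proof. by rewrite /crossp !hornerE !horner_lift !comp_polyXr mulrC subrr. Qed.

Lemma coef_crossp p q i : (crossp p q)`_i = p`_i *: q - q`_i *: p.
Proof. by rewrite /crossp !(coefD, coefN, coefZ) !coef_map /= -!mul_polyC mulrC [p * _]mulrC. Qed.

Lemma crossp_typed p q : inv p q -> typed q (crossp p q).
Proof.
move=> Hpq i; rewrite coef_crossp; apply: invB; apply: invZ => //.
exact: inv_refl.
Qed.

Lemma crossp_linear p q a b c d :
  crossp (a *: p + b *: q) (c *: p + d *: q) = (a * d - b * c)%:P *: crossp p q.
Proof.
apply/polyP => i; rewrite coefZ !coef_crossp !(coefD, coefZ) mul_polyC.
apply/polyP => j; rewrite !(coefD, coefN, coefZ); ring.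
Qed.

(** * Curve polynomials, Gauss's lemma and Lueroth's theorem *)

Local Notation at_z x := (map_poly (horner_eval x)).

Lemma at_z_eq0_factor x Q : at_z x Q = 0 -> exists Q1, Q = ('X - x%:P) *: Q1.
Proof.
move=> Q0; exists (map_poly (fun p => p %/ ('X - x%:P)) Q).
apply/polyP => i; rewrite coefZ coef_map_id0 ?div0p //.
rewrite mulrC divpK // dvdp_XsubCl rootE.
by have := congr1 (fun p : {poly C} => p`_i) Q0; rewrite coef_map coef0 /= /horner_eval => ->.
Qed.

(** Gauss's lemma by removing the roots of d one at a time: setting z to a root x kills Q M but not
    M, so ('X - x) divides all coefficients of Q. Over an algebraically closed field, primitivity of
    M means that no value of z kills it. *)
Lemma gauss_dvd d V Q M : d != 0 -> (forall x, at_z x M != 0) ->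
  d *: V = Q * M -> exists Q', V = Q' * M.
Proof.
move: {2}(size d) (leqnn (size d)) => n.
elim: n d Q => [|n IHn] d Q; first by rewrite leqn0 size_poly_eq0 => /eqP-> /eqP.
move=> le_d nz_d M_prim eqV.
have [/eqP size_d|/closed_rootP[x]] := boolP (size d == 1%N).
  have [c nz_c def_d] := size_poly1P _ (introT eqP size_d).
  exists (c^-1%:P *: Q); rewrite -scalerAl -eqV def_d scalerA -polyCM mulVf //.
  by rewrite scale1r.
rewrite -dvdp_XsubCl => /divpK def_d.
set d' := d %/ _ in def_d.
have nz_d' : d' != 0 by apply: contraNneq nz_d; rewrite -def_d => ->; rewrite mul0r.
have /at_z_eq0_factor[Q1 defQ] : at_z x Q = 0.
  apply/eqP; move: (congr1 (map_poly (horner_eval x)) eqV); rewrite rmorphM /= -def_d.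
  rewrite -mul_polyC rmorphM /= map_polyC /= /horner_eval hornerM !hornerE subrr mulr0.
  rewrite mul0r => /esym/eqP; rewrite mulf_eq0 => /orP[//|].
  by move/negP: (M_prim x).
apply: (IHn d' Q1) => //.
  by move: le_d; rewrite -def_d size_Mmonic ?monicXsubC // size_XsubC addn2.
have nzX : ('X - x%:P : {poly C}) != 0 by rewrite polyXsubC_eq0.
apply: (mulfI (x := ('X - x%:P)%:P)); first by rewrite polyC_eq0.
by rewrite !mul_polyC scalerA mulrC def_d eqV defQ -scalerAl.
Qed.

(** Up to the denominator q, a nonzero polynomial in w over the invariant fractions with root w = z.
    One of least degree in w is a multiple of the minimal polynomial of z over K. *)
Definition curve M :=
  [/\ M != 0, M.['X] = 0 & exists2 q, q != 0 & typed q M].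

Lemma curve_crossp p q : q != 0 -> inv p q -> crossp p q != 0 -> curve (crossp p q).
Proof.
by move=> nz_q Hpq nzV; split=> //; [apply: crossp_diag|exists q => //; apply: crossp_typed].
Qed.

(** Dividing by the leading coefficient makes the polynomial monic over K, so that coefficient is an
    admissible denominator. *)
Lemma curve_typed M : curve M -> typed (lead_coef M) M.
Proof.
move=> [nzM _ [q nz_q typM]] i; apply: (inv_trans nz_q) => //.
exact/inv_sym/typM.
Qed.

Lemma curve_size_gt1 M : curve M -> (1 < size M)%N.
Proof.
move=> [nzM M0 _]; rewrite ltnNge; apply/negP => /size1_polyC defM.
by rewrite defM hornerC in M0; rewrite defM M0 eqxx in nzM.
Qed.

(* Pseudo-division by a curve polynomial of minimal degree in w: a remainder
   would be a curve polynomial of smaller degree. *)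
Lemma minimal_pseudo_dvd M V q : curve M ->
  (forall M', curve M' -> (size M <= size M')%N) ->
  q != 0 -> typed q V -> V.['X] = 0 ->
  exists (d : {poly C}) Q, d != 0 /\ d *: V = Q * M.
Proof.
move=> curveM minM; have typM := curve_typed curveM.
have [nzM M0 _] := curveM; have gt1M := curve_size_gt1 curveM.
set l := lead_coef M in typM; have nz_l : l != 0 by rewrite lead_coef_eq0.
move: {2}(size V) (leqnn (size V)) => n.
elim: n V q => [|n IHn] V q le_V nz_q typV V0.
  move: le_V; rewrite leqn0 size_poly_eq0 => /eqP->.
  by exists 1, 0; rewrite oner_neq0 mul0r scaler0.
have [->|nzV] := eqVneq V 0; first by exists 1, 0; rewrite oner_neq0 mul0r scaler0.
have le_MV : (size M <= size V)%N by apply: minM; split => //; exists q.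
set k := (size V - size M)%N; set v := lead_coef V.
pose V' := l *: V - (v *: 'X^k) * M.
have le_V' : (size V' <= n)%N.
  rewrite -ltnS (leq_trans _ le_V) // (polySpred nzV) ltnS.
  apply/leq_sizeP => j; rewrite leq_eqVlt => /orP[/eqP<-|ltj].
    rewrite coefB coefZ -scalerAl coefZ coefXnM ltnNge leq_subLR.
    rewrite /k [(size V).-1 in X in _ - X]/=.
    have -> : ((size V).-1 - (size V - size M) = (size M).-1)%N by lia.
    have -> : (size V <= size M + (size V).-1)%N by lia.
    by rewrite /= -!lead_coefE mulrC subrr.
  have leVj : (size V <= j)%N by rewrite (polySpred nzV).
  rewrite coefB coefZ -scalerAl coefZ coefXnM ltnNge leq_subLR.
  rewrite [V`_j]nth_default // mulr0 [M`_ _]nth_default ?if_same ?mulr0 ?subr0 //.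
  by rewrite leq_subRL ?subnK // (leq_trans (leq_subr _ _) leVj).
have [d [Q [nz_d eqQ]]] : exists (d : {poly C}) Q, d != 0 /\ d *: V' = Q * M.
  apply: (IHn V' (q * l)) => //; first by rewrite mulf_neq0.
    move=> j; rewrite /V' coefB coefZ -scalerAl coefZ coefXnM; apply: invB.
      by rewrite mulrC; apply: invMr.
    by case: ifP => _; [rewrite mulr0; apply: inv0|exact: (invM (typV _) (typM _))].
  by rewrite /V' hornerD hornerN hornerZ hornerM V0 M0 !mulr0 subrr.
exists (d * l), (Q + d *: (v *: 'X^k)); split; first by rewrite mulf_neq0.
rewrite mulrDl -eqQ /V' -scalerA scalerBr -!scalerAl.
by rewrite addrNK.
Qed.

(** Minimize the degree in w, then the degree in z of the leading coefficient. A common factor 'X -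
    x of the coefficients could be divided out, which would lower the second measure. *)
Lemma primitive_curve_exists M0 : curve M0 ->
  exists M, [/\ curve M, forall M', curve M' -> (size M <= size M')%N
    & forall x, at_z x M != 0].
Proof.
move=> curveM0.
have [M1 curveM1 min1] := classical_argmin (fun M => size M) (ex_intro _ M0 curveM0).
have [M [curveM leM] minM] : exists2 M, curve M /\ (size M <= size M1)%N &
    forall M', curve M' /\ (size M' <= size M1)%N ->
      (size (lead_coef M) <= size (lead_coef M'))%N.
  by apply: classical_argmin; exists M1.
exists M; split => // [M' /min1|x]; first exact: leq_trans.
apply/negP => /eqP/at_z_eq0_factor[M' defM].
have [nzM diagM _] := curveM.
have nzX : ('X - x%:P : {poly C}) != 0 by rewrite polyXsubC_eq0.
have nzM' : M' != 0 by apply: contraNneq nzM => M'0; rewrite defM M'0 scaler0.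
have sizeM' : size M' = size M by rewrite defM size_scale.
have leadM : lead_coef M = ('X - x%:P) * lead_coef M' by rewrite defM lead_coefZ.
have curveM' : curve M'.
  split => //.
    move: diagM; rewrite defM hornerZ => /eqP; rewrite mulf_eq0 (negPf nzX).
    by move/eqP.
  exists (lead_coef M'); first by rewrite lead_coef_eq0.
  move=> i; apply: (inv_cancel nzX); rewrite ![_ * ('X - _)]mulrC -leadM.
  by move: (curve_typed curveM i); rewrite {1}defM coefZ.
have := minM M' (conj curveM' _); rewrite sizeM' leadM => /(_ leM).
rewrite size_monicM ?monicXsubC ?lead_coef_eq0 // size_XsubC.
by rewrite add2n /= ltnn.
Qed.

Lemma crossp_eq0_proportional p q : q != 0 -> crossp p q = 0 ->
  p = (p`_(size q).-1 / lead_coef q) *: q.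
Proof.
rewrite -lead_coef_eq0 => nz_q /(congr1 (fun V : {poly {poly C}} => V`_(size q).-1)).
rewrite coef_crossp coef0 -lead_coefE => /eqP; rewrite subr_eq0 => /eqP eq_pq.
by rewrite mulrC -scalerA eq_pq scalerA mulVf // scale1r.
Qed.

Lemma proportional_crossp_eq0 g h a b : (a != 0) || (b != 0) -> a *: h = b *: g -> crossp g h = 0.
Proof.
move=> nz_ab eq_gh; apply/polyP => i; rewrite coef_crossp coef0.
have [a0|nz_a] := eqVneq a 0.
  move: nz_ab eq_gh; rewrite a0 eqxx scale0r /= => nz_b /esym/eqP.
  by rewrite scaler_eq0 (negPf nz_b) => /eqP->; rewrite coef0 scale0r scaler0 subrr.
have := congr1 (fun p : {poly C} => p`_i) eq_gh; rewrite !coefZ => eq_i.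
apply: (scalerI nz_a); rewrite scaler0 scalerBr !scalerA eq_i.
by rewrite [a * _]mulrC -scalerA eq_gh scalerA [b * _]mulrC subrr.
Qed.

(** This symmetry turns the bound on the degree in w into one on the degree in z. *)
Lemma swapXY_crossp p q : swapXY (crossp p q) = crossp q p.
Proof.
rewrite /crossp rmorphB /= -!mul_polyC !rmorphM /= !swapXY_polyC !swapXY_map_polyC.
by rewrite [X in X - _]mulrC [X in _ - X]mulrC.
Qed.

Lemma size_crossp_le p q : (size (crossp p q) <= maxn (size p) (size q))%N.
Proof.
apply/leq_sizeP => i; rewrite geq_max => /andP[le_p le_q].
by rewrite coef_crossp !nth_default // !scale0r subrr.
Qed.

Lemma crossp_common_factor d g h : crossp (g * d) (h * d) = d *: (d^:P * crossp g h).
Proof.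
rewrite /crossp !rmorphM /= -!mul_polyC !polyCM; ring.
Qed.

(* Lueroth: the invariant fractions are generated by one fraction g / h.  The
   degree in z of a primitive curve polynomial M bounds that of [crossp g h], and M
   divides [crossp g h], so that M and [crossp g h] agree up to a constant. *)
Lemma luroth_generator p0 q0 : q0 != 0 -> inv p0 q0 -> crossp p0 q0 != 0 ->
  exists g h, [/\ coprimep g h, inv g h, crossp g h != 0 &
    forall p q, q != 0 -> inv p q -> exists Q, crossp p q = Q * crossp g h].
Proof.
move=> nz_q0 inv0 nzV0.
have [M [curveM minM primM]] := primitive_curve_exists (curve_crossp nz_q0 inv0 nzV0).
have dvdM p q : q != 0 -> inv p q -> exists Q, crossp p q = Q * M.
  move=> nz_q inv_pq.
  have [d [Q [nz_d eqQ]]] :=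
    minimal_pseudo_dvd curveM minM nz_q (crossp_typed inv_pq) (crossp_diag p q).
  exact: (gauss_dvd nz_d primM eqQ).
set l := lead_coef M; have typM : typed l M := curve_typed curveM.
have [nzM diagM _] := curveM.
have nz_l : l != 0 by rewrite lead_coef_eq0.
(* Some coefficient of M divided by l is not constant: otherwise M = l(z) c(w), and vanishing on the
   diagonal would force c = 0. This coefficient, in lowest terms, is the generator. *)
have [i nzVi] : exists i, crossp M`_i l != 0.
  apply: NNPP => no_i.
  have V0 i : crossp M`_i l = 0.
    by apply/eqP/negPn/negP => nz; apply: no_i; exists i.
  pose c := \poly_(i < size M) ((M`_i)`_(size l).-1 / lead_coef l).
  have defM : M = l *: c^:P.
    apply/polyP => i; rewrite coefZ coef_map coef_poly /=.
    case: ltnP => [_|le_i]; last by rewrite nth_default // mulr0.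
    by rewrite mulrC mul_polyC -crossp_eq0_proportional.
  move: diagM nzM; rewrite defM hornerZ horner_lift comp_polyXr => /eqP.
  by rewrite mulf_eq0 (negPf nz_l) => /eqP->; rewrite rmorph0 scaler0 eqxx.
set d := gcdp M`_i l; set g := M`_i %/ d; set h := l %/ d.
have nz_d : d != 0 by rewrite gcdp_eq0 (negPf nz_l) andbF.
have def_g : M`_i = g * d by rewrite divpK ?dvdp_gcdl.
have def_h : l = h * d by rewrite divpK ?dvdp_gcdr.
have cop_gh : coprimep g h by apply: coprimep_div_gcd; rewrite nz_l orbT.
have inv_gh : inv g h.
  by apply: (inv_cancel nz_d); rewrite -def_g -def_h; apply: typM.
have nz_V : crossp g h != 0.
  by apply: contraNneq nzVi; rewrite def_g def_h crossp_common_factor => ->; rewrite mulr0 scaler0.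
have nz_h : h != 0 by apply: contraNneq nz_l; rewrite def_h => ->; rewrite mul0r.
have [Q defV] := dvdM g h nz_h inv_gh.
have [nzQ _] : Q != 0 /\ M != 0.
  by move: nz_V; rewrite defV mulf_eq0 negb_or => /andP.
have nz_swM : swapXY M != 0 by rewrite swapXY_eq0.
have nz_swQ : swapXY Q != 0 by rewrite swapXY_eq0.
have le_gh : (maxn (size g) (size h) <= size (swapXY M))%N.
  rewrite -sizeYE geq_max; apply/andP; split.
    have [->|nz_g] := eqVneq g 0; first by rewrite size_poly0.
    apply: leq_trans (max_size_coefXY M i); rewrite def_g size_mul // (polySpred nz_d).
    by rewrite addnS leq_addr.
  apply: leq_trans (max_size_coefXY M (size M).-1); rewrite -lead_coefE -/l.
  by rewrite def_h size_mul // (polySpred nz_d) addnS leq_addr.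
have [r def_swQ] : exists r, swapXY Q = r%:P.
  have : (size (swapXY Q) <= 1)%N.
    have : (size (swapXY Q * swapXY M)%R <= size (swapXY M))%N.
      rewrite -rmorphM /= -defV swapXY_crossp; apply: leq_trans (size_crossp_le h g) _.
      by rewrite maxnC.
    rewrite size_mul // (polySpred nz_swM) addnS /=.
    by rewrite -[X in (_ <= X)%N]add1n leq_add2r.
  by move/size1_polyC => ->; eexists.
have defQ : Q = r^:P by rewrite -swapXY_polyC -def_swQ swapXYK.
(* The quotient r involves w alone. At a root x of r, setting w = x gives g(x) h = h(x) g; as g and
   h are not proportional, g(x) = h(x) = 0, against coprimality. *)
have size_r : size r = 1%N.
  apply/eqP/negPn/negP => /closed_rootP[x /eqP rx].
  have := congr1 (fun V : {poly {poly C}} => V.[x%:P]) defV.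
  rewrite /crossp hornerM defQ horner_lift_polyC rx mul0r hornerD hornerN !hornerZ.
  rewrite !horner_lift_polyC ![_ * _%:P]mulrC !mul_polyC => /eqP; rewrite subr_eq0 => /eqP.
  move=> eq_gh; case/negP: nz_V; apply/eqP; apply: proportional_crossp_eq0 eq_gh.
  rewrite -negb_and; apply/negP => /andP[gx hx].
  by have := coprimep_root cop_gh gx; rewrite hx.
have /size_poly1P[c nz_c def_r] := introT eqP size_r.
have defM : M = c^-1%:P%:P * crossp g h.
  rewrite defV defQ def_r map_polyC /= mulrA -!polyCM mulVf //.
  by rewrite mul1r.
exists g, h; split => // p q nz_q /(dvdM p q nz_q)[Q' ->].
by exists (Q' * c^-1%:P%:P); rewrite -mulrA -defM.
Qed.

(** * The generator in normal form *)

(** The leading coefficient in w shows the denominator, so that divisibility of [crossp] polynomials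
    yields divisibility of denominators. *)
Lemma lead_coef_crossp p q : (size q < size p)%N -> lead_coef (crossp p q) = lead_coef p *: q.
Proof.
have [->|nz_q] := eqVneq q 0.
  by rewrite /crossp scale0r rmorph0 scaler0 subrr lead_coef0 scaler0.
move=> lt_qp; have nz_p : p != 0 by rewrite -size_poly_gt0 (leq_ltn_trans _ lt_qp).
have coefV : (crossp p q)`_(size p).-1 = lead_coef p *: q.
  rewrite coef_crossp lead_coefE [q`_ _]nth_default ?scale0r ?subr0 //.
  by rewrite -ltnS -polySpred.
have nzV : (crossp p q)`_(size p).-1 != 0 by rewrite coefV scaler_eq0 lead_coef_eq0 negb_or nz_p.
rewrite lead_coefE -coefV; congr (_`_ _); apply/eqP; rewrite eqn_leq; apply/andP; split.
  have := size_crossp_le p q; rewrite (maxn_idPl (ltnW lt_qp)); lia.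
have : ((size p).-1 < size (crossp p q))%N by rewrite ltnNge; apply: contra nzV => /leq_sizeP->.
lia.
Qed.

(** A linear change of generator makes the denominator h of lower degree than g. Leading
    coefficients in w then show that h divides 'X^n, so h is 'X^e up to a constant. If e > 0,
    coprimality gives g(0) != 0. If e = 0, the pole of F / 'X^n at 0 forces g - g(0) to be a
    multiple of a power of z. *)
Lemma normal_generator F n : (0 < n)%N -> (n.+1 < size F)%N -> F.[0] != 0 ->
  inv F 'X^n ->
  (exists2 N, (0 < N)%N & inv 'X^N 1) \/
  exists g e, [/\ (0 < e)%N, (e.+1 < size g)%N, g.[0] != 0, inv g 'X^e &
    forall p q, q != 0 -> inv p q -> exists Q, crossp p q = Q * crossp g 'X^e].
Proof.
move=> n_gt0 size_F F0 inv_F.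
have nzXn m : ('X^m : {poly C}) != 0 by rewrite -size_poly_eq0 size_polyXn.
have nzF : F != 0 by rewrite -size_poly_gt0 (leq_ltn_trans _ size_F).
have leadV : lead_coef (crossp F 'X^n) = lead_coef F *: 'X^n.
  by rewrite lead_coef_crossp // size_polyXn.
have nzV : crossp F 'X^n != 0.
  by rewrite -lead_coef_eq0 leadV scaler_eq0 lead_coef_eq0 negb_or nzF nzXn.
have [g [h [cop inv_gh nz_gh gen_gh]]] :
    exists g h, [/\ coprimep g h, inv g h, (size h < size g)%N &
      forall p q, q != 0 -> inv p q -> exists Q, crossp p q = Q * crossp g h].
  have [g [h [cop inv_gh nzVgh gen_gh]]] := luroth_generator (nzXn n) inv_F nzV.
  have change g' h' a : a != 0 -> crossp g' h' = a%:P *: crossp g h ->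
      forall p q, q != 0 -> inv p q -> exists Q, crossp p q = Q * crossp g' h'.
    move=> nz_a eqV p q nz_q /(gen_gh p q nz_q)[Q ->].
    exists (Q * a^-1%:P%:P); rewrite eqV -mul_polyC mulrA -[Q * _ * _]mulrA -!polyCM.
    by rewrite mulVf // mulr1.
  have [lt_hg|lt_gh|eq_gh] := ltngtP (size h) (size g); first by exists g, h; split.
    exists h, g; split => //; [by rewrite coprimep_sym|exact: inv_sym|].
    apply: (change _ _ (-1)); rewrite ?oppr_eq0 ?oner_neq0 //.
    have := crossp_linear g h 0 1 1 0; rewrite !scale1r !scale0r add0r addr0 => ->.
    by rewrite mulr1 mul0r sub0r.
  have nz_g : g != 0.
    apply: contraNneq nzVgh => g0; move: eq_gh; rewrite g0 size_poly0.
    by move/eqP; rewrite size_poly_eq0 => /eqP->; rewrite /crossp !scale0r subrr.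
  (* With equal degrees, this multiple of g cancels the leading term of h. *)
  pose c := - (lead_coef h / lead_coef g); pose h' := c *: g + 1 *: h.
  exists g, h'; split.
  - by rewrite /h' scale1r -mul_polyC coprimep_addl_mul.
  - apply: inv_sym; apply: invD; first by apply: invZ; apply: inv_refl.
    by apply: invZ; apply: inv_sym.
  - rewrite (polySpred nz_g) ltnS; apply/leq_sizeP => j; rewrite leq_eqVlt => /orP[/eqP<-|].
      rewrite coefD !coefZ -lead_coefE -eq_gh -lead_coefE mul1r /c mulNr.
      by rewrite divfK ?lead_coef_eq0 // addNr.
    rewrite -ltnS -(polySpred nz_g) => le_j.
    by rewrite coefD !coefZ !nth_default -?eq_gh ?eq_gh // !mulr0 addr0.
  apply: (change _ _ 1); rewrite ?oner_neq0 //.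
  have := crossp_linear g h 1 0 c 1; rewrite scale1r scale0r addr0 => ->.
  by rewrite mulr1 mul0r subr0.
have nz_g : g != 0 by rewrite -size_poly_gt0 (leq_ltn_trans _ nz_gh).
have [Q defV] := gen_gh _ _ (nzXn n) inv_F.
have dvd_h : h %| 'X^n.
  have := leadV; rewrite defV lead_coefM (lead_coef_crossp nz_gh) => eq_lead.
  rewrite -(@dvdpZr _ (lead_coef F)) ?lead_coef_eq0 // -eq_lead -mul_polyC.
  by rewrite !dvdp_mull.
have [e e_le_n eqp_h] : exists2 e, (e <= n)%N & h %= 'X^e.
  by have := @dvdp_exp_XsubCP _ h 0 n; rewrite polyC0 subr0 => XnP; apply/XnP.
have def_h : h = lead_coef h *: 'X^e.
  by have := eqp_eq eqp_h; rewrite lead_coefXn scale1r.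
have nz_c : lead_coef h != 0.
  by rewrite lead_coef_eq0; apply: contraTneq eqp_h => ->; rewrite eqp_sym eqp0 nzXn.
set c := lead_coef h in def_h nz_c.
have eqV : crossp g h = c%:P *: crossp g 'X^e.
  have := crossp_linear g 'X^e 1 0 0 c; rewrite scale1r !scale0r addr0 add0r -def_h => ->.
  by rewrite mul1r mul0r subr0.
have inv_ge : inv g 'X^e.
  apply/inv_sym; have -> : 'X^e = c^-1 *: h by rewrite def_h scalerA mulVf ?scale1r.
  by apply: invZ; apply: inv_sym.
have gt_ge : (e.+1 < size g)%N by move: nz_gh; rewrite def_h size_scale // size_polyXn.
have gen_ge p q : q != 0 -> inv p q -> exists Q, crossp p q = Q * crossp g 'X^e.
  move=> nz_q /(gen_gh p q nz_q)[Q' ->]; exists (Q' * c%:P%:P).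
  by rewrite eqV -mul_polyC mulrA.
case: (posnP e) => [e0|e_gt0]; last first.
  right; exists g, e; split => //.
  have := coprimep_root cop; rewrite def_h => cop0; apply/negP => /cop0.
  by rewrite hornerZ hornerXn expr0n (gtn_eqF e_gt0) mulr0 eqxx.
left; rewrite e0 expr0 in inv_ge gen_ge gt_ge.
have [Q' defV'] := gen_ge _ _ (nzXn n) inv_F.
pose g0 := g - g.[0]%:P.
(* At w = 0 the relation between the two [crossp] polynomials becomes F(0) z^n = Q'(0) (g(0) -
   g(z)). *)
have dvd_g0 : g0 %| 'X^n.
  have := congr1 (fun V : {poly {poly C}} => V.[0%:P]) defV'.
  rewrite /crossp hornerM !hornerD !hornerN !hornerZ !horner_lift_polyC hornerXn.
  rewrite expr0n (gtn_eqF n_gt0) polyC0 mulr0 subr0 mul1r hornerC polyC1 mulr1 => eq0.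
  rewrite -(@dvdpZr _ F.[0]) // -mul_polyC mulrC eq0 -opprB mulrN dvdpNr.
  exact: dvdp_mull.
have [N N_le_n eqp_g0] : exists2 N, (N <= n)%N & g0 %= 'X^N.
  by have := @dvdp_exp_XsubCP _ g0 0 n; rewrite polyC0 subr0 => XnP; apply/XnP.
have size_g0 : size g0 = size g.
  by rewrite size_polyDl // size_polyN (leq_ltn_trans (size_polyC_leq1 _)).
exists N.
  rewrite lt0n; apply/eqP => N0; have := eqp_size eqp_g0.
  by rewrite N0 size_g0 size_polyXn => size_g; rewrite size_g in gt_ge.
have := eqp_eq eqp_g0; rewrite lead_coefXn scale1r => def_g0.
have nz_lg0 : lead_coef g0 != 0 by rewrite lead_coef_eq0 -size_poly_gt0 size_g0 size_poly_gt0.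
set c0 := lead_coef g0 in def_g0 nz_lg0.
have -> : 'X^N = c0^-1 *: g0 by rewrite def_g0 scalerA mulVf ?scale1r.
apply: invZ; apply: invB => //; exists 0%N => k _.
by rewrite !hornerE.
Qed.

(** * Invariant Laurent polynomials and forms in terms of the generator *)

Lemma at_z_crossp x p q : at_z x (crossp p q) = q.[x] *: p - p.[x] *: q.
Proof.
apply/polyP => i; rewrite coef_map coef_crossp /= /horner_eval !hornerE.
by rewrite !(coefD, coefN, coefZ) mulrC [q`_i * _]mulrC.
Qed.

Section Generator.
Variables (g : {poly C}) (e : nat).
Hypotheses (e_gt0 : (0 < e)%N) (size_g : (e.+1 < size g)%N) (g0 : g.[0] != 0).
Hypothesis inv_g : inv g 'X^e.
Hypothesis gen_g : forall p q, q != 0 -> inv p q -> exists Q, crossp p q = Q * crossp g 'X^e.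

Definition laurent_val (x : C) := g.[x] / x ^+ e.

(* With s = g / z^e, this expands F / z^n = (D / z^e) R(s) in powers of s - s(x0).
   Each step removes a factor s - s(x0) and so lowers the order of the pole at 0
   and at infinity, down to the constants, which are the hypothesis. *)
Lemma laurent_module D : D != 0 -> (size D <= size g)%N ->
  (forall c, inv (c *: 'X^e) D ->
     exists R, forall x : C, x != 0 -> c * x ^+ e = D.[x] * R.[laurent_val x]) ->
  forall m n F, (size F <= (n + m).+1)%N -> inv (F * 'X^e) (D * 'X^n) ->
  exists R, forall x : C, x != 0 -> F.[x] * x ^+ e = D.[x] * x ^+ n * R.[laurent_val x].
Proof.
move=> nzD size_D base m n.
move: {2}(n + m)%N (leqnn (n + m)) => d; elim: d m n => [|d IHd] m n le_d F size_F inv_F.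
  move: le_d; rewrite leqn0 addn_eq0 => /andP[/eqP n0 /eqP m0].
  move: size_F inv_F; rewrite n0 m0 expr0 mulr1 => /size1_polyC ->.
  rewrite mul_polyC => /base[R defR]; exists R => x /defR.
  by rewrite hornerC expr0 mulr1.
have nzXn j : ('X^j : {poly C}) != 0 by rewrite -size_poly_eq0 size_polyXn.
have [nm0|nm_gt0] := posnP (n + m)%N; first by apply: (IHd m n) => //; rewrite nm0.
(* A base point where F z^e / (D z^n) is finite; its value f / t there is subtracted so that a zero
   at s = s(x0) appears. *)
have [x0 nz_x0 Dx0] : exists2 x0 : C, x0 != 0 & D.[x0] != 0.
  have [K /(_ K (leqnn K))[]] := generic (mulf_neq0 nzD (nzXn 1%N)).
  by rewrite hornerM hornerXn mulf_eq0 negb_or => /andP[]; exists (z K).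
pose P : {poly C} := F * 'X^e; pose T : {poly C} := D * 'X^n.
rewrite -/P -/T in inv_F.
have nzT : T != 0 by rewrite mulf_neq0.
have [Q /(congr1 (at_z x0))] := gen_g nzT inv_F.
rewrite rmorphM /= !at_z_crossp => eqG.
(* G is x0^e z^e (s - s(x0)). It does not vanish at 0, hence is coprime to the powers of z. *)
pose G : {poly C} := 'X^e.[x0] *: g - g.[x0] *: 'X^e; rewrite -/G in eqG.
(* Extracting the common power z^k before dividing by G makes the new exponent exactly the truncated
   difference n - e, also when n < e. *)
set k := minn n e; set t := T.[x0] in eqG; set f := P.[x0] in eqG.
have nz_t : t != 0 by rewrite /t hornerM mulf_neq0 // hornerXn expf_neq0.
pose Phi : {poly C} := t *: (F * 'X^(e - k)) - f *: (D * 'X^(n - k)).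
have eqPhi : t *: P - f *: T = Phi * 'X^k.
  rewrite /Phi mulrBl -!scalerAl -!mulrA -!exprD !subnK ?geq_minl ?geq_minr //.
have size_G : size G = size g.
  rewrite /G hornerXn size_polyDl size_scale ?expf_neq0 //.
  by rewrite size_polyN (leq_ltn_trans (size_scale_leq _ _)) ?size_polyXn.
have G0 : G.[0] != 0.
  rewrite /G hornerD hornerN !hornerZ !hornerXn expr0n (gtn_eqF e_gt0) mulr0 subr0.
  by rewrite mulf_neq0 ?expf_neq0.
have [Q1 defPhi] : exists Q1 : {poly C}, Phi = Q1 * G.
  have : G %| Phi * 'X^k by rewrite -eqPhi eqG dvdp_mull.
  rewrite Gauss_dvdpl => [/divpK <-|]; first by eexists.
  by rewrite coprimep_expr // coprimepX rootE.
have nzG : G != 0 by apply: contraNneq G0 => ->; rewrite horner0.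
(* The order of the pole of s at infinity; e is its order at 0, so that dividing by s - s(x0) lowers
   m by p and n by e. *)
pose p := (size g - e.+1)%N.
pose n1 := (n - e)%N; pose m1 := (m - p)%N.
have size_Q1 : (size Q1 <= (n1 + m1).+1)%N.
  have [->|nzQ1] := eqVneq Q1 0; first by rewrite size_poly0.
  have : (size Phi <= maxn (size F + (e - k)) (size D + (n - k)))%N.
    have size_MXn q j : (size (q * 'X^j)%R <= size q + j)%N.
      by apply: leq_trans (size_polyMleq _ _) _; rewrite size_polyXn addnS.
    apply: leq_trans (size_polyD _ _) _; rewrite size_polyN geq_max !leq_max.
    have le1 := leq_trans (size_scale_leq t _) (size_MXn F (e - k)%N).
    have le2 := leq_trans (size_scale_leq f _) (size_MXn D (n - k)%N).
    by rewrite le1 le2 orbT.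
  rewrite defPhi size_mul // size_G /n1 /m1 /p /k.
  move: size_F size_D size_g; clear; move: (size F) (size D) (size g) (size Q1).
  move=> sF sD sg sQ; lia.
have inv_Q1 : inv (Q1 * 'X^e) (D * 'X^n1).
  have nzGX : G * 'X^e != 0 by rewrite mulf_neq0.
  apply: (inv_cancel nzGX).
  have -> : Q1 * 'X^e * (G * 'X^e) = (Phi * 'X^e) * 'X^e by rewrite defPhi; ring.
  have -> : D * 'X^n1 * (G * 'X^e) = (D * 'X^(n + (e - k))) * G.
    have -> : (n + (e - k) = n1 + e)%N by rewrite /n1 /k; lia.
    by rewrite exprD; ring.
  apply: invM; last first.
    apply: inv_sym; apply: invB; apply: invZ => //; exact: inv_refl.
  rewrite /Phi mulrBl -!scalerAl; apply: invB; apply: invZ.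
    rewrite exprD mulrA -[X in inv X _]mulrA [_ * 'X^e]mulrC mulrA.
    exact: invMr.
  have -> : D * 'X^(n - k) * 'X^e = D * 'X^(n + (e - k)).
    by rewrite -mulrA -exprD; congr (_ * 'X^_); rewrite /k; lia.
  exact: inv_refl.
have le_d1 : (n1 + m1 <= d)%N by rewrite /n1 /m1 /p; lia.
have [R1 defR1] := IHd m1 n1 le_d1 Q1 size_Q1 inv_Q1.
exists (t^-1 *: (f%:P + R1 * (x0 ^+ e *: 'X - g.[x0]%:P))) => x nz_x.
set s := laurent_val x; apply: (mulfI nz_t).
have eqR : t * (t^-1 *: (f%:P + R1 * (x0 ^+ e *: 'X - g.[x0]%:P))).[s]
    = f + R1.[s] * (x0 ^+ e * s - g.[x0]).
  by rewrite hornerZ mulrA divff // mul1r !hornerE.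
rewrite [RHS]mulrCA eqR.
have := congr1 (horner^~ x) eqPhi.
rewrite defPhi /P /T !hornerD !hornerN !hornerZ !hornerM !hornerXn.
move=> /eqP; rewrite subr_eq => /eqP ->.
have -> : G.[x] = x ^+ e * (x0 ^+ e * s - g.[x0]).
  have nz_y : x ^+ e != 0 by rewrite expf_neq0.
  rewrite /G hornerD hornerN !hornerZ !hornerXn /s /laurent_val; move: (x ^+ e) nz_y => y nz_y.
  by field.
have -> : x ^+ n = x ^+ n1 * x ^+ k by rewrite -exprD; congr (_ ^+ _); rewrite /n1 /k; lia.
rewrite [Q1.[x] * (_ * _)]mulrA defR1 //; ring.
Qed.

(** [laurent_module] with D = 'X^e, where constants are themselves polynomials in s and the base
    case is immediate. *)
Lemma laurent_algebra n F : inv F 'X^n ->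
  exists R, forall x : C, x != 0 -> F.[x] = x ^+ n * R.[laurent_val x].
Proof.
move=> inv_F; have nzXe : ('X^e : {poly C}) != 0 by rewrite -size_poly_eq0 size_polyXn.
have [||||R defR] := @laurent_module 'X^e nzXe _ _ (size F) n F.
- by rewrite size_polyXn ltnW.
- by move=> c _; exists c%:P => x _; rewrite hornerXn hornerC mulrC.
- by apply: leqW; apply: leq_addl.
- by rewrite ['X^e * _]mulrC; apply: invMr.
exists R => x nz_x; have nz_y : x ^+ e != 0 by rewrite expf_neq0.
by apply: (mulIf nz_y); rewrite defR // hornerXn; ring.
Qed.

(* D / z^e is z times the derivative of g / z^e.  An invariant form c dz/z, with
   c a nonzero constant, would make D / z^e an affine function of g / z^e, which
   its leading coefficients at 0 and at infinity exclude. *)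
Lemma laurent_forms n F : let D := 'X * g^`() - e%:R *: g in
  inv (F * 'X^e) (D * 'X^n) ->
  exists R, forall x : C, x != 0 -> F.[x] * x ^+ e = D.[x] * x ^+ n * R.[laurent_val x].
Proof.
move=> D inv_F; have nzXe : ('X^e : {poly C}) != 0 by rewrite -size_poly_eq0 size_polyXn.
have D0 : D.[0] = - (e%:R * g.[0]).
  by rewrite /D hornerD hornerN hornerZ hornerM hornerX mul0r add0r.
have nz_g : g != 0 by apply: contraNneq g0 => ->; rewrite horner0.
have coefD_ i : D`_i = (i%:R - e%:R) * g`_i.
  rewrite /D coefD coefN coefZ coefXM coef_deriv.
  case: i => [|i] /=; first by rewrite mulr0n !sub0r mulNr.
  by rewrite mulrBl [i.+1%:R * _]mulr_natl.
have nzD : D != 0.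
  apply: contraNneq g0 => D_eq0; move: D0; rewrite D_eq0 horner0 => /esym/eqP.
  by rewrite oppr_eq0 mulf_eq0 pnatr_eq0 (gtn_eqF e_gt0).
have size_D : (size D <= size g)%N.
  by apply/leq_sizeP => j le_j; rewrite coefD_ nth_default ?mulr0.
have [|||R defR] := @laurent_module D nzD size_D _ (size F) n F; last by exists R.
- move=> c inv_c; have [->|nz_c] := eqVneq c 0.
    by exists 0 => x _; rewrite mul0r horner0 mulr0.
  have inv_D : inv D 'X^e.
    apply: inv_sym; have -> : 'X^e = c^-1 *: (c *: 'X^e) by rewrite scalerA mulVf ?scale1r.
    exact: invZ.
  have lt_eg : (size ('X^e : {poly C}) < size g)%N by rewrite size_polyXn.
  have nz_diff : ((size g).-1%:R - e%:R : C) != 0.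
    by rewrite subr_eq0 eqr_nat; apply/negP => /eqP; lia.
  have lead_D : D`_(size g).-1 != 0 by rewrite coefD_ mulf_neq0 ?lead_coef_eq0.
  have eq_size : size D = size g.
    apply/eqP; rewrite eqn_leq size_D leqNgt /=; apply: contra lead_D => lt_Dg.
    by rewrite nth_default // -ltnS (leq_trans lt_Dg) ?leqSpred.
  have lt_eD : (size ('X^e : {poly C}) < size D)%N by rewrite eq_size.
  have [Q defQ] := gen_g nzXe inv_D.
  have nzV p : (size ('X^e : {poly C}) < size p)%N -> crossp p 'X^e != 0.
    move=> lt_ep; rewrite -lead_coef_eq0 lead_coef_crossp // scaler_eq0 negb_or nzXe andbT.
    by rewrite lead_coef_eq0 -size_poly_gt0 (leq_ltn_trans _ lt_ep).
  have size_V p : (size ('X^e : {poly C}) < size p)%N -> size (crossp p 'X^e) = size p.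
    move=> lt_ep; apply/eqP; rewrite eqn_leq; apply/andP; split.
      by have := size_crossp_le p 'X^e; rewrite (maxn_idPl (ltnW lt_ep)).
    have : (crossp p 'X^e)`_(size p).-1 != 0.
      rewrite coef_crossp [('X^e)`_ _]nth_default ?scale0r ?subr0; last by rewrite -ltnS (leq_trans lt_ep) ?leqSpred.
      rewrite scaler_eq0 negb_or nzXe andbT lead_coef_eq0.
      by rewrite -size_poly_gt0 (leq_ltn_trans _ lt_ep).
    by rewrite leqNgt; apply: contra => lt_p; rewrite nth_default // -ltnS (leq_trans lt_p) ?leqSpred.
  have nzQ : Q != 0 by apply: contraNneq (nzV D lt_eD) => Q0; rewrite defQ Q0 mul0r.
  (* Both [crossp] polynomials have the same degree in w, so the quotient is free of w. *)
  have [r defQr] : exists r, Q = r%:P.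
    have := congr1 (fun V : {poly {poly C}} => size V) defQ.
    rewrite size_mul ?nzV // !size_V // eq_size => size_Q.
    have le_Q : (size Q <= 1)%N.
      move: size_Q; rewrite (polySpred nz_g) addnS /= -[X in X = _]add1n => /eqP.
      by rewrite eqn_add2r => /eqP <-.
    by exists Q`_0; rewrite -size1_polyC.
  have := congr1 lead_coef defQ.
  rewrite defQr lead_coefM lead_coefC !lead_coef_crossp // => eq_lead.
  have := congr1 (fun V : {poly {poly C}} => V.[0%:P]) defQ.
  rewrite defQr hornerM hornerC /crossp !hornerD !hornerN !hornerZ !horner_lift_polyC.
  rewrite hornerXn expr0n (gtn_eqF e_gt0) polyC0 !mulr0 !subr0 => eq_0.
  have lead_defD : lead_coef D = ((size g).-1%:R - e%:R) * lead_coef g.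
    by rewrite lead_coefE eq_size coefD_.
  (* Leading coefficients in w give r = deg g - e, whereas the terms at w = 0 give r = - e; together
     they make deg g = 0. *)
  have def_r : r = ((size g).-1%:R - e%:R)%:P.
    have nz_lXe : lead_coef g *: 'X^e != 0 by rewrite scaler_eq0 negb_or nzXe lead_coef_eq0 nz_g.
    by apply: (mulIf nz_lXe); rewrite -eq_lead lead_defD mul_polyC scalerA.
  move: eq_0; rewrite def_r mulrCA => /(mulfI nzXe); rewrite -polyCM => /polyC_inj.
  rewrite D0 mulrBl -[X in X = _]add0r => /addIr/esym/eqP.
  rewrite mulf_eq0 pnatr_eq0 (negPf g0) orbF => /eqP size_g1.
  by move: size_g; rewrite -[size g]prednK ?size_g1 // size_poly_gt0.
- by apply: leqW; apply: leq_addl.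
- by [].
Qed.
End Generator.

(* With s = g / z^e, the last clause says that the invariant forms (F / z^n) dz / z are
   the R(s) ds. *)
Theorem invariants_structure F n : (0 < n)%N -> (n.+1 < size F)%N -> F.[0] != 0 ->
  inv F 'X^n ->
  (exists2 N, (0 < N)%N & inv 'X^N 1) \/
  exists g e, [/\ (0 < e)%N, (e.+1 < size g)%N, inv g 'X^e,
    forall F n, inv F 'X^n ->
      exists R, forall x : C, x != 0 -> F.[x] = x ^+ n * R.[g.[x] / x ^+ e] &
    forall F n, inv (F * 'X^e) (('X * g^`() - e%:R *: g) * 'X^n) ->
      exists R, forall x : C, x != 0 ->
        F.[x] * x ^+ e = ('X * g^`() - e%:R *: g).[x] * x ^+ n * R.[g.[x] / x ^+ e]].
Proof.
move=> n_gt0 size_F F0 inv_F.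
have [|[g [e [e_gt0 size_g g0 inv_g gen_g]]]] := normal_generator n_gt0 size_F F0 inv_F.
  by left.
right; exists g, e; split => // [F' n' inv_F'|F' n' inv_F'].
  exact: (laurent_algebra e_gt0 size_g g0 inv_g gen_g inv_F').
exact: (laurent_forms e_gt0 size_g g0 inv_g gen_g inv_F').
Qed.
End Invariants.
End InvariantFractions.

(** * Trigonometric polynomials as Laurent polynomials on the unit circle *)

Module CircleComposition.
Import all_boot all_order all_algebra ring zify complex Rstruct.
Import InvariantFractions.
Import GRing.Theory Num.Theory.
Set Implicit Arguments. Unset Strict Implicit. Unset Printing Implicit Defensive.
Local Open Scope ring_scope.
Local Notation R := Rdefinitions.R.
Local Notation C := (complex R).
Local Delimit Scope R_scope with Rdef.

Lemma conjcM (x y : C) : (x * y)^*%C = x^*%C * y^*%C.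
Proof. exact: (rmorphM (@conjc R)). Qed.

Lemma conjcX (x : C) n : (x ^+ n)^*%C = x^*%C ^+ n.
Proof. exact: (rmorphXn (@conjc R)). Qed.

Definition circ (t : R) : C := (cos t +i* sin t)%C.

Arguments circ t%_ring_scope.

Lemma circD s t : circ (s + t) = circ s * circ t.
Proof.
rewrite /circ; simpc; have -> : s + t = Rplus s t by [].
by rewrite cos_plus sin_plus; congr Complex; rewrite addrC.
Qed.

Lemma circ0 : circ 0 = 1.
Proof. by rewrite /circ [cos _]cos_0 [sin _]sin_0. Qed.

Lemma circX t n : circ t ^+ n = circ (t *+ n).
Proof.
elim: n => [|n IHn]; first by rewrite expr0 mulr0n circ0.
by rewrite exprS mulrS circD IHn.
Qed.

Lemma circ_conj t : circ t * (circ t)^*%C = 1.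
Proof.
apply/eqP; rewrite eq_complex /=; apply/andP; split; apply/eqP; last by ring.
by rewrite mulrN opprK addrC; apply: (sin2_cos2 t).
Qed.

Lemma circ_neq0 t : circ t != 0.
Proof.
by apply: contraTneq (oner_neq0 C) => circ_t; rewrite -(circ_conj t) circ_t mul0r eqxx.
Qed.

Lemma circ_inv t : (circ t)^-1 = (circ t)^*%C.
Proof.
by apply: (mulfI (circ_neq0 t)); rewrite divff ?circ_neq0 // circ_conj.
Qed.

Lemma circ_eq1 (t : R) : (0 < t < 2 * PI)%Rdef -> circ t <> 1.
Proof.
by move=> t_bounds /(congr1 (@complex.Re R)) /=; apply: cos_neq1.
Qed.

Definition cderive (phi phi' : R -> C) : Prop := forall t,
  is_derive (fun s => complex.Re (phi s)) t (complex.Re (phi' t)) /\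
  is_derive (fun s => complex.Im (phi s)) t (complex.Im (phi' t)).

Definition ctrig (phi : R -> C) : Prop :=
  trig_poly (fun t => complex.Re (phi t)) /\ trig_poly (fun t => complex.Im (phi t)).

Lemma ctrig_ext (phi psi : R -> C) : phi =1 psi -> ctrig phi -> ctrig psi.
Proof. by move=> eq_phi [H1 H2]; split; [move: H1|move: H2]; apply: trig_poly_ext => t; rewrite eq_phi. Qed.

Lemma ctrig_const (c : C) : ctrig (fun=> c).
Proof. by split; apply: trig_poly_const. Qed.

Lemma ctrigD (phi psi : R -> C) : ctrig phi -> ctrig psi -> ctrig (fun t => phi t + psi t).
Proof.
move=> [H1 H2] [K1 K2]; split.
  apply: trig_poly_ext (trig_poly_plus _ _ H1 K1) => t.
  by case: (phi t) (psi t) => ? ? [].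
apply: trig_poly_ext (trig_poly_plus _ _ H2 K2) => t.
by case: (phi t) (psi t) => ? ? [].
Qed.

Lemma ctrigM (phi psi : R -> C) : ctrig phi -> ctrig psi -> ctrig (fun t => phi t * psi t).
Proof.
move=> [H1 H2] [K1 K2]; split.
  apply: trig_poly_ext (trig_poly_plus _ _ (trig_poly_mult _ _ H1 K1)
    (trig_poly_scal (-1)%R _ (trig_poly_mult _ _ H2 K2))) => t.
  by case: (phi t) (psi t) => ? ? [? ?] /=; rewrite RplusE !RmultE; ring.
apply: trig_poly_ext (trig_poly_plus _ _ (trig_poly_mult _ _ H1 K2) (trig_poly_mult _ _ H2 K1)) => t.
by case: (phi t) (psi t) => ? ? [].
Qed.

Lemma ctrig_circ : ctrig circ.
Proof. by split; [apply: trig_poly_cos|apply: trig_poly_sin]. Qed.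

Lemma ctrig_conj (phi : R -> C) : ctrig phi -> ctrig (fun t => (phi t)^*%C).
Proof.
move=> [H1 H2]; split; first by apply: trig_poly_ext H1 => t; case: (phi t).
apply: trig_poly_ext (trig_poly_scal (-1)%R _ H2) => t.
by case: (phi t) => ? ? /=; rewrite RmultE; ring.
Qed.

Lemma ctrigX (phi : R -> C) n : ctrig phi -> ctrig (fun t => phi t ^+ n).
Proof.
move=> Hphi; elim: n => [|n IHn]; first exact: ctrig_const.
by apply: ctrig_ext (ctrigM Hphi IHn) => t; rewrite exprS.
Qed.

Lemma ctrig_horner (p : {poly C}) : ctrig (fun t => p.[circ t]).
Proof.
elim/poly_ind: p => [|p c IHp].
  by apply: ctrig_ext (ctrig_const 0) => t; rewrite horner0.
apply: ctrig_ext (ctrigD (ctrigM IHp ctrig_circ) (ctrig_const c)) => t.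
by rewrite hornerMXaddC.
Qed.

Lemma cderive_ext (phi psi phi' psi' : R -> C) :
  phi =1 psi -> phi' =1 psi' -> cderive phi phi' -> cderive psi psi'.
Proof.
move=> eq1 eq2 H t; have [H1 H2] := H t; rewrite -eq2; split.
  by apply: is_derive_ext H1 => s; rewrite eq1.
by apply: is_derive_ext H2 => s; rewrite eq1.
Qed.

Lemma cderive_unique (phi phi1 phi2 : R -> C) :
  cderive phi phi1 -> cderive phi phi2 -> phi1 =1 phi2.
Proof.
move=> H1 H2 t; have [R1 I1] := H1 t; have [R2 I2] := H2 t.
move: (is_derive_unique _ _ _ R1) (is_derive_unique _ _ _ I1).
rewrite (is_derive_unique _ _ _ R2) (is_derive_unique _ _ _ I2).
by case: (phi1 t) (phi2 t) => ? ? [? ?] /= -> ->.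
Qed.

Lemma cderive_const (c : C) : cderive (fun=> c) (fun=> 0).
Proof. by move=> t; split; apply: (is_derive_const (V := R_NormedModule)). Qed.

Lemma cderiveD (phi psi phi' psi' : R -> C) : cderive phi phi' -> cderive psi psi' ->
  cderive (fun t => phi t + psi t) (fun t => phi' t + psi' t).
Proof.
move=> H K t; have [R1 I1] := H t; have [R2 I2] := K t.
have ReD (x y : C) : complex.Re (x + y) = complex.Re x + complex.Re y by case: x y => ? ? [].
have ImD (x y : C) : complex.Im (x + y) = complex.Im x + complex.Im y by case: x y => ? ? [].
split; rewrite ?ReD ?ImD.
  by apply: is_derive_ext (is_derive_plus (V := R_NormedModule) _ _ _ _ _ R1 R2) => s; rewrite ReD.
by apply: is_derive_ext (is_derive_plus (V := R_NormedModule) _ _ _ _ _ I1 I2) => s; rewrite ImD.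
Qed.

Lemma cderiveM (phi psi phi' psi' : R -> C) : cderive phi phi' -> cderive psi psi' ->
  cderive (fun t => phi t * psi t) (fun t => phi' t * psi t + phi t * psi' t).
Proof.
move=> H K t; have [R1 I1] := H t; have [R2 I2] := K t.
have mul_deriv := fun f g l m Hf Hg => is_derive_mult (K := R_AbsRing) f g t l m Hf Hg Rmult_comm.
split.
  have := is_derive_minus (V := R_NormedModule) _ _ _ _ _ (mul_deriv _ _ _ _ R1 R2) (mul_deriv _ _ _ _ I1 I2).
  set l := (X in is_derive _ _ X) => Hl.
  have -> : complex.Re (phi' t * psi t + phi t * psi' t) = l.
    rewrite /l /minus /plus /opp /mult /=.
    case: (phi t) (psi t) (phi' t) (psi' t) => ? ? [? ?] [? ?] [? ?] /=.
    by rewrite -[Hierarchy.opp _]/(Ropp _) !RplusE RoppE !RmultE; ring.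
  by refine (is_derive_ext _ _ _ _ _ Hl) => s; case: (phi s) (psi s) => ? ? [].
have := is_derive_plus (V := R_NormedModule) _ _ _ _ _ (mul_deriv _ _ _ _ R1 I2) (mul_deriv _ _ _ _ I1 R2).
set m := (X in is_derive _ _ X) => Hm.
have -> : complex.Im (phi' t * psi t + phi t * psi' t) = m.
  rewrite /m /plus /mult /=.
  case: (phi t) (psi t) (phi' t) (psi' t) => ? ? [? ?] [? ?] [? ?] /=.
  by rewrite !RplusE !RmultE; ring.
by refine (is_derive_ext _ _ _ _ _ Hm) => s; case: (phi s) (psi s) => ? ? [].
Qed.

Lemma cderive_circ : cderive circ (fun t => 'i%C * circ t).
Proof.
move=> t; split => /=.
  by rewrite mul0r sub0r mul1r; apply: is_derive_cos.
by rewrite mul0r add0r mul1r; apply: is_derive_sin.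
Qed.

Lemma cderive_conj (phi phi' : R -> C) : cderive phi phi' ->
  cderive (fun t => (phi t)^*%C) (fun t => (phi' t)^*%C).
Proof.
move=> H t; have [H1 H2] := H t; split.
  have -> : complex.Re (phi' t)^*%C = complex.Re (phi' t) by case: (phi' t).
  by apply: is_derive_ext H1 => s; case: (phi s).
have -> : complex.Im (phi' t)^*%C = Ropp (complex.Im (phi' t)) by case: (phi' t).
by apply: is_derive_ext (is_derive_opp (V := R_NormedModule) _ _ _ H2) => s; case: (phi s).
Qed.

Lemma cderive_real (f f' : R -> R) : (forall t, is_derive f t (f' t)) ->
  cderive (fun t => (f t)%:C%C) (fun t => (f' t)%:C%C).
Proof. by move=> H t; split => //=; apply: (is_derive_const (V := R_NormedModule)). Qed.

Lemma cderiveX (phi phi' : R -> C) n : cderive phi phi' ->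
  cderive (fun t => phi t ^+ n.+1) (fun t => n.+1%:R * phi t ^+ n * phi' t).
Proof.
move=> H; elim: n => [|n IHn].
  by apply: cderive_ext H => t; rewrite ?expr1 // expr0 !mul1r.
apply: cderive_ext (cderiveM H IHn) => t; first by rewrite [in RHS]exprS.
by rewrite [n.+2%:R]mulrS exprS; ring.
Qed.

Lemma cderive_horner (p : {poly C}) :
  cderive (fun t => p.[circ t]) (fun t => 'i%C * (circ t * p^`().[circ t])).
Proof.
elim/poly_ind: p => [|p c IHp].
  by apply: cderive_ext (cderive_const 0) => t; rewrite ?deriv0 !horner0 ?mulr0.
apply: cderive_ext (cderiveD (cderiveM IHp cderive_circ) (cderive_const c)) => t.
  by rewrite hornerMXaddC.
by rewrite derivMXaddC hornerD hornerMX; ring.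
Qed.

(** Along z = e^{it} the operator d/dt is i z d/dz, which explains the numerator z g' - e g in
    [laurent_forms]. *)
Lemma cderive_laurent (g : {poly C}) (e : nat) : (0 < e)%N ->
  cderive (fun t => g.[circ t] / circ t ^+ e)
    (fun t => 'i%C * (('X * g^`() - e%:R *: g).[circ t] / circ t ^+ e)).
Proof.
case: e => // e _.
apply: cderive_ext (cderiveM (cderive_horner g) (cderiveX e (cderive_conj cderive_circ))) => t.
  by rewrite -circ_inv exprVn.
have -> : ('i%C * circ t)^*%C = - 'i%C * (circ t)^*%C.
  rewrite conjcM; congr (_ * _); apply/eqP.
  by rewrite eq_complex /= oppr0 !eqxx.
rewrite -circ_inv hornerD hornerN hornerZ hornerM hornerX exprVn [in RHS]exprSr.
rewrite [in LHS]exprSr !exprVn; have := circ_neq0 t; move: (circ t) => z nz_z.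
have nz_y : z ^+ e != 0 by rewrite expf_neq0.
move: (z ^+ e) nz_y => y nz_y; move: ('i%C : C) => i.
by field; rewrite nz_z nz_y.
Qed.

(** * Laurent representations on the unit circle *)

Lemma injective_generic (x : nat -> C) (p : {poly C}) : injective x -> p != 0 ->
  exists K, forall k, (K <= k)%N -> p.[x k] != 0.
Proof.
move=> inj_x nz_p; apply: NNPP => no_K.
have many m : exists2 rs : seq C, size rs = m & uniq rs && all (root p) rs.
  suff [rs [size_rs uniq_rs roots _]] : exists rs : seq nat, [/\ size rs = m, uniq rs,
      all (root p \o x) rs & True].
    by exists (map x rs); rewrite ?size_map // map_inj_uniq // uniq_rs all_map.
  elim: m => [|m [rs [size_rs uniq_rs roots _]]]; first by exists [::].
  have [k le_k root_k] : exists2 k, (\max_(i <- rs) i.+1 <= k)%N & root p (x k).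
    apply: NNPP => no_k; apply: no_K; exists (\max_(i <- rs) i.+1)%N => k le_k.
    by apply/negP => root_k; apply: no_k; exists k.
  exists (k :: rs); split; rewrite //= ?size_rs ?root_k // uniq_rs andbT.
  by apply/negP => k_rs; move: le_k; rewrite leqNgt (leq_bigmax_seq _ k_rs).
have [rs size_rs /andP[uniq_rs roots]] := many (size p).
by have := max_poly_roots nz_p roots uniq_rs; rewrite size_rs ltnn.
Qed.

Lemma circ_inj_in (s t : R) : (0 < s < 2 * PI)%Rdef -> (0 < t < 2 * PI)%Rdef ->
  circ s = circ t -> s = t.
Proof.
have no_lt (x y : R) : (0 < x < 2 * PI)%Rdef -> (0 < y < 2 * PI)%Rdef -> (x < y)%Rdef ->
    circ x <> circ y.
  move=> Hx Hy lt_xy eq_xy; have := @circ_eq1 (Rminus y x); apply; first by lra.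
  apply: (mulfI (circ_neq0 x)); rewrite -circD mulr1 eq_xy; congr circ.
  by rewrite -RplusE; ring_simplify.
move=> Hs Ht eq_st; case: (Rtotal_order s t) => [|[//|]] lt_st.
  by case: (no_lt s t).
by case: (no_lt t s).
Qed.

(** The conjugate reciprocal polynomial: since the conjugate of z is 1/z on the circle, it
    represents complex conjugation up to the factor z^N. *)
Definition starp (N : nat) (p : {poly C}) : {poly C} :=
  \poly_(j < N.+1) (p`_(N - j))^*%C.

Lemma horner_starp N (p : {poly C}) t : (size p <= N.+1)%N ->
  (starp N p).[circ t] = circ t ^+ N * (p.[circ t])^*%C.
Proof.
move=> size_p; rewrite horner_poly (horner_coef_wide _ size_p) raddf_sum mulr_sumr /=.
rewrite (reindex_inj rev_ord_inj) /=; apply: eq_bigr => j _.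
have le_j : (j <= N)%N by rewrite -ltnS.
rewrite subSS subKn // (rmorphM (@conjc R)) (rmorphXn (@conjc R)) mulrCA; congr (_ * _).
have -> : circ t ^+ N = circ t ^+ (N - j) * circ t ^+ j by rewrite -exprD subnK.
by rewrite -mulrA -exprMn circ_conj expr1n mulr1.
Qed.

Definition laurent_rep (f : R -> R) (n : nat) (F : {poly C}) : Prop :=
  (size F <= n.*2.+1)%N /\ forall t, (f t)%:C%C * circ t ^+ n = F.[circ t].

Lemma trig_laurent_rep (f : R -> R) : trig_poly f -> exists n F, laurent_rep f n F.
Proof.
move: f; apply: trig_poly_ind.
- move=> f g eq_fg [n [F [size_F repF]]]; exists n, F; split => // t.
  by rewrite -eq_fg.
- move=> c i j.
  pose Fs : {poly C} := (2%:R * 'i%C)^-1 *: ('X^2 - 1).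
  pose Fc : {poly C} := 2%:R^-1 *: ('X^2 + 1).
  have nz2 : (2%:R : C) != 0 by rewrite pnatr_eq0.
  have nzi : 'i%C != 0 :> C by rewrite eq_complex /= eqxx oner_eq0.
  have repFs t : (sin t)%:C%C * circ t = Fs.[circ t].
    rewrite /Fs hornerZ hornerD hornerN hornerXn hornerC.
    apply: (mulfI (mulf_neq0 nz2 nzi)); rewrite mulrA [RHS]mulrA divff ?mulf_neq0 // mul1r.
    have -> : circ t ^+ 2 - 1 = circ t * (circ t - (circ t)^*%C).
      by rewrite mulrBr circ_conj expr2.
    rewrite subcJ -[complex.Im _]/(sin t); ring.
  have repFc t : (cos t)%:C%C * circ t = Fc.[circ t].
    rewrite /Fc hornerZ hornerD hornerXn hornerC.
    apply: (mulfI nz2); rewrite mulrA [RHS]mulrA divff // mul1r.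
    have -> : circ t ^+ 2 + 1 = circ t * (circ t + (circ t)^*%C).
      by rewrite mulrDr circ_conj expr2.
    rewrite addcJ -[complex.Re _]/(cos t); ring.
  have size_Fs : (size Fs <= 3)%N.
    by rewrite (leq_trans (size_scale_leq _ _)) // -polyC1 size_XnsubC.
  have size_Fc : (size Fc <= 3)%N.
    by rewrite (leq_trans (size_scale_leq _ _)) // -polyC1 size_XnaddC.
  exists (i + j)%N, (c%:C%C *: (Fs ^+ i * Fc ^+ j)); split => [|t].
    have le_X (p : {poly C}) k : (size p <= 3)%N -> (size (p ^+ k)%R <= k.*2.+1)%N.
      move=> size_p; apply: leq_trans (size_poly_exp_leq p k) _.
      rewrite ltnS -mul2n leq_mul2r; apply/orP; right.
      by move: size_p; case: (size p) => [|[|[|[]]]].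
    apply: leq_trans (size_scale_leq _ _) _; apply: leq_trans (size_polyMleq _ _) _.
    have := le_X _ i size_Fs; have := le_X _ j size_Fc; lia.
  rewrite hornerZ hornerM !horner_exp -repFs -repFc !RmultE !RpowE.
  rewrite !rmorphM !rmorphXn /= !exprMn exprD; ring.
move=> f g [n [F [size_F repF]]] [m [G [size_G repG]]].
exists (n + m)%N, ('X^m * F + 'X^n * G); split => [|t].
  have size_X (p : {poly C}) k l : (size p <= k)%N -> (size ('X^l * p)%R <= l + k)%N.
    by move=> ?; apply: leq_trans (size_polyMleq _ _) _; rewrite size_polyXn addSn leq_add2l.
  apply: leq_trans (size_polyD _ _) _; rewrite geq_max; apply/andP; split.
    by apply: leq_trans (size_X _ _ m size_F) _; lia.
  by apply: leq_trans (size_X _ _ n size_G) _; lia.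
rewrite hornerD !hornerM !hornerXn -repF -repG RplusE rmorphD /= exprD; ring.
Qed.

Lemma circle_poly_ext (p q : {poly C}) : (forall t, p.[circ t] = q.[circ t]) -> p = q.
Proof.
move=> eq_pq; apply/eqP; rewrite -subr_eq0; apply/negPn/negP => nz_pq.
have bounds k : (0 < / (INR k + 1) < 2 * PI)%Rdef.
  have := pos_INR k; have := PI2_1 => PI_gt k_ge0.
  have : (/ (INR k + 1) <= / 1)%Rdef by apply: Rinv_le_contravar; lra.
  have : (0 < / (INR k + 1))%Rdef by apply: Rinv_0_lt_compat; lra.
  by rewrite Rinv_1; lra.
have [|K /(_ K (leqnn K))] := @injective_generic (fun k => circ (/ (INR k + 1))%Rdef) _ _ nz_pq.
  move=> i j /(circ_inj_in (bounds i) (bounds j)) /Rinv_eq_reg eq_ij.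
  by apply: INR_eq; lra.
by rewrite hornerD hornerN eq_pq subrr eqxx.
Qed.

(** Take n minimal. As f is real, F is its own conjugate reciprocal, so its coefficients of degree 0
    and 2n are conjugate; if they vanished, F / 'X would represent f with n - 1. Hence the poles at
    0 and at infinity both have order n. *)
Lemma trig_poly_laurent_normal (f : R -> R) : trig_poly f -> (exists t, f t <> f 0%Rdef) ->
  exists n (F : {poly C}), [/\ (0 < n)%N, (n.+1 < size F)%N, F.[0] != 0 & laurent_rep f n F].
Proof.
move=> /trig_laurent_rep rep_f [t0 f_t0].
have [n [F repF] min_n] := @classical_argmin _ (fun n => exists F, laurent_rep f n F) id rep_f.
have [size_F valF] := repF.
have n_gt0 : (0 < n)%N.
  rewrite lt0n; apply/eqP => n0; apply: f_t0; apply: (@complexI R).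
  move: size_F valF; rewrite n0 => /size1_polyC -> valF.
  have := valF t0; have := valF 0%Rdef; rewrite !hornerC !expr0 !mulr1 => -> ->.
  by [].
have F_star : F = starp n.*2 F.
  apply: circle_poly_ext => t; rewrite horner_starp // -valF.
  rewrite conjcM conjcX conjc_real.
  rewrite mulrCA; congr (_ * _); rewrite -addnn exprD -mulrA -exprMn.
  by rewrite circ_conj expr1n mulr1.
have F0 : F.[0] != 0.
  apply/negP => F0; have coef0 : F`_0 = 0 by rewrite -horner_coef0; apply/eqP.
  have coef2n : F`_n.*2 = 0.
    by rewrite F_star coef_poly ltnSn subnn coef0 conjc0.
  have := F0; rewrite -rootE -dvdp_XsubCl polyC0 subr0 => /divpK.
  set G := F %/ 'X => defF.
  have repG : laurent_rep f n.-1 G.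
    split=> [|t].
      have [->|nzG] := eqVneq G 0; first by rewrite size_poly0.
      have : (size F <= n.*2)%N.
        apply/leq_sizeP => j; rewrite leq_eqVlt => /orP[/eqP<- //|lt_j].
        by rewrite nth_default // (leq_trans size_F).
      rewrite -defF size_mulX // => lt_G.
      by rewrite -ltnS (leq_trans lt_G) // -{1}(prednK n_gt0) doubleS.
    apply: (mulIf (circ_neq0 t)); rewrite -mulrA -exprSr prednK // valF -defF.
    by rewrite hornerMX.
  have := min_n n.-1 (ex_intro _ G repG).
  by rewrite leqNgt ltn_predL n_gt0.
exists n, F; split => //.
suff : F`_n.*2 != 0.
  move=> nzF; have : (n.*2 < size F)%N by rewrite ltnNge; apply: contra nzF => ?; rewrite nth_default.
  by apply: leq_trans; rewrite ltnS -addnn -addn1 leq_add2l.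
rewrite F_star coef_poly ltnSn subnn conjc_eq0 -horner_coef0.
exact: F0.
Qed.

(** * Return to real polynomials and real curves *)

Lemma complex_horner_Re (p : {poly C}) (x : R) :
  complex.Re p.[x%:C%C] = (map_poly (@complex.Re R) p).[x].
Proof.
rewrite (horner_coef p); have ReD : {morph (@complex.Re R) : x y / x + y} by move=> [? ?] [? ?].
have -> : complex.Re (\sum_(i < size p) p`_i * x%:C%C ^+ i)
    = \sum_(i < size p) complex.Re p`_i * x ^+ i.
  rewrite (big_morph _ ReD (erefl : complex.Re 0 = 0)); apply: eq_bigr => i _.
  by rewrite -rmorphXn /=; case: (p`_i) => ? ? /=; rewrite mulr0 subr0.
rewrite (horner_coef_wide x (size_poly _ _)); apply: eq_bigr => i _.
by rewrite coef_poly ltn_ord.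
Qed.

Lemma poly_fun_horner (p : {poly R}) : poly_fun (fun y => p.[y]).
Proof.
exists (size p).-1, (fun k => p`_k) => y.
rewrite sum_f_R0E big_mkord.
have [->|nz_p] := eqVneq p 0.
  by rewrite horner0 size_poly0 big_ord1 coef0 RmultE mul0r.
by rewrite horner_coef -polySpred //; apply: eq_bigr => i _; rewrite RmultE RpowE.
Qed.

Lemma is_derive_horner (p : {poly R}) (y : R) : is_derive (fun y => p.[y]) y p^`().[y].
Proof.
elim/poly_ind: p => [|p c IHp].
  rewrite deriv0 horner0.
  refine (is_derive_ext (fun=> 0%Rdef) _ _ _ _ (is_derive_const (V := R_NormedModule) 0%Rdef y)).
  by move=> t; rewrite horner0.
rewrite derivMXaddC hornerD hornerMX.
have := is_derive_plus (V := R_NormedModule) _ _ _ _ _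
  (is_derive_mult (K := R_AbsRing) _ _ _ _ _ IHp (is_derive_id _) Rmult_comm)
  (is_derive_const (V := R_NormedModule) c y).
rewrite /plus /mult /one /zero /= => H.
have -> : p.[y] + p^`().[y] * y = Rplus (Rplus (Rmult p^`().[y] y) (Rmult p.[y] 1%Rdef)) 0%Rdef.
  by rewrite !RplusE !RmultE addr0 mulr1 addrC.
by refine (is_derive_ext _ _ _ _ _ H) => t; rewrite hornerMXaddC.
Qed.

(** If c != -1, then (1 + c) sigma = 2 Re sigma - d; if c = -1, then 2 sigma = 2 i Im sigma + d. *)
Lemma affine_real_curve (sigma : R -> C) (c d : C) : ctrig sigma ->
  (forall t, (sigma t)^*%C = c * sigma t + d) ->
  exists (h : R -> R) (l m : C), [/\ trig_poly h, l != 0 & forall t, sigma t = l * (h t)%:C%C + m].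
Proof.
move=> [trig_Re trig_Im] conj_sigma; have nz2 : (2%:R : C) != 0 by rewrite pnatr_eq0.
have nzi : 'i%C != 0 :> C by rewrite eq_complex /= eqxx oner_eq0.
have [c1|nz_c] := eqVneq (1 + c) 0.
  exists (fun t => complex.Im (sigma t)), 'i%C, (d / 2%:R); split => // t.
  have := subcJ (sigma t); rewrite conj_sigma.
  have -> : c = -1 by apply/eqP; rewrite -addr_eq0 addrC c1.
  move: ('i%C : C) ((complex.Im (sigma t))%:C%C) => i y eq_sigma.
  apply: (mulfI nz2); rewrite mulrDr [2%:R * (d / _)]mulrCA divff // mulr1.
  have -> : 2%:R * (i * y) = 2%:R * y * i by ring.
  by rewrite -eq_sigma; ring.
exists (fun t => complex.Re (sigma t)), (2%:R / (1 + c)), (- d / (1 + c)); split => //.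
  by rewrite mulf_neq0 ?invr_eq0.
move=> t; have := addcJ (sigma t); rewrite conj_sigma => eq_sigma.
move: ((complex.Re (sigma t))%:C%C) eq_sigma => y eq_sigma; apply: (mulfI nz_c).
have -> : (1 + c) * (2%:R / (1 + c) * y + - d / (1 + c)) = 2%:R * y - d by field.
by rewrite -eq_sigma; ring.
Qed.

(** The values g(x) / x^e along the sequence cannot all lie among the finitely many roots c of W:
    each is taken only at roots of g - c 'X^e, which is nonzero by degree. *)
Lemma laurent_generic (x : nat -> C) (g W : {poly C}) (e : nat) :
  injective x -> (forall k, x k != 0) -> (e.+1 < size g)%N ->
  (forall k, W.[g.[x k] / x k ^+ e] = 0) -> W = 0.
Proof.
move=> inj_x nz_x size_g W0; apply/eqP/negPn/negP => nzW.
have [rs defW] := closed_field_poly_normal W.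
pose p := \prod_(c <- rs) (g - c *: 'X^e).
have nz_p : p != 0.
  rewrite prodf_seq_neq0; apply/allP => c _ /=; rewrite subr_eq0.
  apply: contraTneq size_g => ->; rewrite -leqNgt (leq_trans (size_scale_leq _ _)) //.
  by rewrite size_polyXn.
have [K /(_ K (leqnn K))/negP[]] := injective_generic inj_x nz_p.
have := W0 K; rewrite defW hornerZ => /eqP; rewrite mulf_eq0 lead_coef_eq0 (negPf nzW) /=.
rewrite /p !horner_prod !prodf_seq_eq0 => /hasP[c c_rs]; rewrite /= hornerXsubC subr_eq0 => /eqP eq_c.
apply/hasP; exists c => //=; rewrite hornerD hornerN hornerZ hornerXn -eq_c.
by rewrite divfK ?subrr // expf_neq0.
Qed.

(** * The composition obtained from a sequence of pairs *)

Section Pairs.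
Variables (A a b : R -> R) (r s : nat -> R).
Hypotheses (trig_A : trig_poly A) (trig_a : trig_poly a) (trig_b : trig_poly b).
Hypothesis derive_A : forall t, is_derive A t (a t).
Hypothesis nz_a : exists t, a t <> 0%Rdef.
Hypothesis rs_bounds : forall k, (0 < r k /\ r k < s k /\ s k < 2 * PI)%Rdef.
Hypotheses (inj_r : injective r) (inj_s : injective s).
Hypothesis A_rs : forall k, A (r k) = A (s k).
Hypothesis ab_rs : forall k, (a (r k) * b (s k) = a (s k) * b (r k))%Rdef.
Hypothesis rs_close : forall eps, (0 < eps)%Rdef ->
  exists K, forall k, (K <= k)%N -> (s k - r k < eps)%Rdef.

Let z k := circ (r k).
Let w k := circ (s k).
Local Notation inv := (InvariantFractions.inv z w).

Lemma z_inj : injective z.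
Proof.
move=> i j /circ_inj_in eq_r; apply/inj_r/eq_r; have := rs_bounds i; have := rs_bounds j; lra.
Qed.

Lemma w_inj : injective w.
Proof.
move=> i j /circ_inj_in eq_s; apply/inj_s/eq_s; have := rs_bounds i; have := rs_bounds j; lra.
Qed.

Lemma pairs_generic (p : {poly C}) : p != 0 ->
  exists K, forall k, (K <= k)%N -> p.[z k] != 0 /\ p.[w k] != 0.
Proof.
move=> nz_p; have [K1 H1] := injective_generic z_inj nz_p.
have [K2 H2] := injective_generic w_inj nz_p.
exists (maxn K1 K2) => k; rewrite geq_max => /andP[le1 le2]; split; [exact: H1|exact: H2].
Qed.

(** Invariance of z^N would give e^{i N (s - r)} = 1, which fails as soon as 0 < N (s - r) < 2
    pi. *)
Lemma pow_not_inv N : (0 < N)%N -> ~ inv 'X^N 1.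
Proof.
move=> N_gt0 [K1 H1]; have INR_N : (0 < INR N)%Rdef by apply: lt_0_INR; apply/ltP.
have [|K2 H2] := rs_close (eps := (2 * PI / INR N)%Rdef).
  by apply: Rdiv_lt_0_compat => //; have := PI_RGT_0; lra.
set k := maxn K1 K2; have := H1 k (leq_maxl _ _); have := H2 k (leq_maxr _ _).
rewrite !hornerXn -polyC1 !hornerC !mulr1 /z /w !circX => close_k eq_k.
have [_ [lt_rs _]] := rs_bounds k.
have := @circ_eq1 (INR N * (s k - r k))%Rdef; apply.
  split; first by apply: Rmult_lt_0_compat; lra.
  apply: (Rmult_lt_reg_l (/ INR N)); first exact: Rinv_0_lt_compat.
  rewrite -Rmult_assoc Rinv_l; last by lra.
  by rewrite Rmult_1_l Rmult_comm; apply: close_k.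
apply: (mulfI (circ_neq0 (r k *+ N))); rewrite mulr1 -circD eq_k; apply: (congr1 circ).
by rewrite RmultE RminusE INRE mulr_natl -mulrnDl addrC subrK.
Qed.

Theorem composition_of_pairs : exists P Q h : R -> R,
  [/\ poly_fun P, poly_fun Q, trig_poly h &
    forall t, a t = (P (h t) * Derive h t)%Rdef /\ b t = (Q (h t) * Derive h t)%Rdef].
Proof.
have [n [F [n_gt0 size_F F0 [_ repF]]]] : exists n (F : {poly C}),
    [/\ (0 < n)%N, (n.+1 < size F)%N, F.[0] != 0 & laurent_rep A n F].
  apply: trig_poly_laurent_normal => //; apply: NNPP => no_t.
  have constA t : A t = A 0%Rdef by apply: NNPP => neq; apply: no_t; exists t.
  have [t0 []] := nz_a; rewrite -(is_derive_unique _ _ _ (derive_A t0)).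
  rewrite (Derive_ext _ (fun=> A 0%Rdef)) ?Derive_const //.
have inv_F : inv F 'X^n.
  by exists 0%N => k _; rewrite !hornerXn -!repF A_rs; ring.
have [[N N_gt0 /pow_not_inv []] //|] := invariants_structure pairs_generic n_gt0 size_F F0 inv_F.
move=> [g [e [e_gt0 size_g inv_g alg forms]]].
pose sigma t := g.[circ t] / circ t ^+ e.
have nz_ze t : circ t ^+ e != 0 by rewrite expf_neq0 ?circ_neq0.
pose N := (size g).-1.
have size_gN : (size g <= N.+1)%N by rewrite /N leqSpred.
have conj_sigma t : (sigma t)^*%C = (starp N g * 'X^e).[circ t] / circ t ^+ N.
  rewrite hornerM hornerXn horner_starp // /sigma.
  rewrite conjcM conjc_inv conjcX -circ_inv exprVn invrK.
  by rewrite mulrAC [_ * (_)^*%C]mulrC mulfK ?expf_neq0 ?circ_neq0.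
have inv_sigma : exists K, forall k, (K <= k)%N -> sigma (r k) = sigma (s k).
  have [K H] := inv_g; exists K => k /H; rewrite !hornerXn => eq_k.
  by apply/eqP; rewrite eqr_div //; apply/eqP.
(* Conjugation preserves equality at the pairs, so the conjugate of sigma is again an invariant
   Laurent polynomial and hence a polynomial T in sigma. *)
have inv_conj : inv (starp N g * 'X^e) 'X^N.
  have [K H] := inv_sigma; exists K => k /H /(congr1 (@conjc R)); rewrite !conj_sigma !hornerXn.
  by move/eqP; rewrite eqr_div ?expf_neq0 ?circ_neq0 // => /eqP.
have [T defT] := alg _ _ inv_conj.
have conjT t : (sigma t)^*%C = T.[sigma t].
  by rewrite conj_sigma defT ?circ_neq0 // mulrAC divff ?mul1r // expf_neq0 ?circ_neq0.
(* Conjugation is an involution, so the conjugate of T composed with T fixes infinitely many values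
   of sigma; degrees then make T affine. *)
have TT : map_poly (@conjc R) T \Po T = 'X.
  apply/eqP; rewrite -subr_eq0; apply/eqP.
  apply: (laurent_generic (x := z) (g := g) (e := e) z_inj) => // k; first exact: circ_neq0.
  rewrite hornerD hornerN hornerX horner_comp -/(sigma (r k)) -conjT.
  have -> : (map_poly (@conjc R) T).[(sigma (r k))^*%C] = (T.[sigma (r k)])^*%C.
    exact: (horner_map (@conjc R)).
  by rewrite -conjT conjcK subrr.
have size_T : size T = 2%N.
  have := size_comp_poly (map_poly (@conjc R) T) T; rewrite TT size_polyX => /esym/eqP.
  by rewrite muln_eq1 => /andP[_]; case: (size T) => [|[|[|]]].
have [h [l [m [trig_h nz_l def_sigma]]]] :
    exists (h : R -> R) (l m : C), [/\ trig_poly h, l != 0 & forall t, sigma t = l * (h t)%:C%C + m].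
  apply: (@affine_real_curve sigma T`_1 T`_0).
    apply: ctrig_ext (ctrigM (ctrig_horner g) (ctrigX e (ctrig_conj ctrig_circ))) => t.
    by rewrite -circ_inv exprVn.
  by move=> t; rewrite conjT horner_coef size_T !big_ord_recl big_ord0 /= expr0 expr1; ring.
have derive_h t : is_derive h t (Derive h t).
  exact: (Derive_correct _ _ (trig_poly_ex_derive _ trig_h t)).
set h' := Derive h in derive_h *.
pose D : {poly C} := 'X * g^`() - e%:R *: g; rewrite -/D in forms.
have nzi : 'i%C != 0 :> C by rewrite eq_complex /= eqxx oner_eq0.
have valD t : D.[circ t] = 'i%C^-1 * l * (h' t)%:C%C * circ t ^+ e.
  have eq_derive : l * (h' t)%:C%C = 'i%C * (D.[circ t] / circ t ^+ e).
    have sigma_l : cderive sigma (fun t => l * (h' t)%:C%C).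
      apply: cderive_ext (cderiveD (cderiveM (cderive_const l) (cderive_real derive_h)) (cderive_const m)).
        by move=> x; rewrite def_sigma.
      by move=> x; rewrite mul0r add0r addr0.
    exact: (cderive_unique sigma_l (cderive_laurent g e_gt0)).
  by rewrite -[_ * l * _]mulrA eq_derive mulKf // divfK.
pose lin : {poly C} := l *: 'X + m%:P.
have val_sigma (p : {poly C}) t : p.[sigma t] = (p \Po lin).[(h t)%:C%C].
  by rewrite horner_comp /lin hornerD hornerZ hornerX hornerC -def_sigma.
have [RA defRA] := alg _ _ inv_F.
(* A and h are real-valued, so taking real parts of the coefficients does not change the value at
   h(t). *)
pose PA := map_poly (@complex.Re R) (RA \Po lin).
have defA t : A t = PA.[h t].
  rewrite /PA -complex_horner_Re -val_sigma.
  have := repF t; rewrite defRA ?circ_neq0 // mulrC => /mulfI <- //.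
  by rewrite expf_neq0 ?circ_neq0.
have def_a t : a t = (PA^`().[h t] * h' t)%Rdef.
  have := is_derive_comp _ _ _ _ _ (is_derive_horner PA (h t)) (derive_h t).
  move=> /is_derive_unique; rewrite (Derive_ext _ A) ?(is_derive_unique _ _ _ (derive_A t)) => [->|x].
    by rewrite Rmult_comm.
  by rewrite defA.
have [nb [Fb [_ repFb]]] := trig_laurent_rep trig_b.
have [na [Fa [_ repFa]]] := trig_laurent_rep trig_a.
have nzFa : Fa != 0.
  apply/negP => /eqP Fa0; have [t0 []] := nz_a; apply: (@complexI R).
  have := repFa t0; rewrite Fa0 horner0 => /eqP; rewrite mulf_eq0 expf_eq0.
  by rewrite (negPf (circ_neq0 t0)) andbF orbF => /eqP.
(* As a = PA'(h) h' and h agrees at each pair, a(r) b(s) = a(s) b(r) loses the factor PA'(h),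
   nonzero because a(r) is nonzero for large k. What remains says that b / h' is invariant, and h'
   is D / z^e up to a constant. *)
have inv_b : inv (Fb * 'X^e) (D * 'X^nb).
  have [K1 H1] := inv_sigma; have [K2 H2] := pairs_generic nzFa.
  exists (maxn K1 K2) => k; rewrite geq_max => /andP[/H1 eq_sigma /H2[nz_ar _]].
  have eq_h : h (r k) = h (s k).
    apply: (@complexI R); apply: (mulfI nz_l); apply: (addIr m).
    by rewrite -!def_sigma.
  have nz_P : PA^`().[h (s k)] != 0.
    apply: contraNneq nz_ar => P0; rewrite -repFa def_a eq_h P0 RmultE mul0r.
    by rewrite mul0r.
  have eq_b : b (r k) * h' (s k) = b (s k) * h' (r k).
    apply: (mulfI nz_P); have := ab_rs k; rewrite !def_a eq_h !RmultE => eq_ab.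
    by rewrite [b (r k) * _]mulrC [b (s k) * _]mulrC !mulrA -eq_ab.
  rewrite !hornerM !hornerXn /z /w !valD -!repFb.
  have eq_bC : (b (r k))%:C%C * (h' (s k))%:C%C = (b (s k))%:C%C * (h' (r k))%:C%C.
    by rewrite -!rmorphM eq_b.
  set zr := circ (r k); set zs := circ (s k).
  transitivity ((b (r k))%:C%C * (h' (s k))%:C%C * (zr ^+ nb * zs ^+ nb * zr ^+ e * zs ^+ e * ('i%C^-1 * l))).
    by ring.
  by rewrite eq_bC; ring.
have [RB defRB] := forms _ _ inv_b.
(* The factor l / i comes from D / z^e = (l / i) h' on the circle. *)
pose QB := map_poly (@complex.Re R) (('i%C^-1 * l) *: (RB \Po lin)).
exists (fun y => PA^`().[y]), (fun y => QB.[y]), h; split => //; try exact: poly_fun_horner.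
move=> t; split; first exact: def_a.
rewrite /QB -complex_horner_Re hornerZ -val_sigma.
have := defRB _ (circ_neq0 t); rewrite valD -repFb -/(sigma t) => eq_b.
have {}eq_b : (b t)%:C%C = 'i%C^-1 * l * RB.[sigma t] * (h' t)%:C%C.
  apply: (mulIf (nz_ze t)); apply: (mulIf (x := circ t ^+ nb)).
    by rewrite expf_neq0 ?circ_neq0.
  by rewrite [LHS]mulrAC eq_b; ring.
have := congr1 (@complex.Re R) eq_b; rewrite [complex.Re _%:C%C]/= => ->.
by case: ('i%C^-1 * l * RB.[sigma t]) => x y /=; rewrite mulr0 subr0.
Qed.
End Pairs.
End CircleComposition.

(** * The sequence of initial values and the conclusion *)

Lemma inv_nat_bounds (k : nat) : 0 < / (INR k + 1) <= 1.
Proof.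
  pose proof (pos_INR k). split; [apply Rinv_0_lt_compat; lra|].
  rewrite <- Rinv_1. apply Rinv_le_contravar; lra.
Qed.

Lemma inv_nat_small (d e : R) : 0 < d -> 0 < e ->
  exists K, forall k, (K <= k)%nat -> d * / (INR k + 1) < e.
Proof.
  intros Hd He. destruct (archimed_cor1 (e / d)) as [K [HK HK0]].
  { now apply Rdiv_lt_0_compat. }
  exists K. intros k Hk.
  assert (HKr : 0 < INR K) by now apply lt_0_INR.
  assert (Hle : / (INR k + 1) <= / INR K).
  { apply Rinv_le_contravar; [exact HKr|]. apply le_INR in Hk. lra. }
  apply Rle_lt_trans with (d * / INR K); [apply Rmult_le_compat_l; lra|].
  apply (Rmult_lt_compat_l d) in HK; [|exact Hd].
  replace (d * (e / d)) with e in HK by (field; lra). exact HK.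
Qed.

Lemma inv_nat_inj (d : R) (i j : nat) : d <> 0 ->
  d * / (INR i + 1) = d * / (INR j + 1) -> i = j.
Proof.
  intros Hd H. apply Rmult_eq_reg_l in H; [|exact Hd]. apply Rinv_eq_reg in H.
  apply INR_eq. lra.
Qed.

Lemma endpoint_sequence (x1 x2 : R) (f : R -> R) : x1 < x2 ->
  (filterlim f (at_right x1) (locally 0) \/ filterlim f (at_left x2) (locally 0)) ->
  exists x : nat -> R, (forall k, x1 < x k < x2) /\ (forall i j, 0 < x i * x j) /\
    (forall i j, x i = x j -> i = j) /\
    (forall eps, 0 < eps -> exists K, forall k, (K <= k)%nat -> f (x k) < eps).
Proof.
  intros H12 [Hf | Hf].
  (* If x1 < 0, the step also stays below - x1, so that all terms are negative; otherwise all are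
     positive. The other endpoint is symmetric. *)
  - set (d := (if Rlt_dec x1 0 then Rmin (x2 - x1) (- x1) else x2 - x1) / 2).
    assert (Hd : 0 < d /\ d < x2 - x1 /\ (x1 < 0 -> x1 + d < 0)).
    { unfold d, Rmin. repeat destruct Rlt_dec; repeat destruct Rle_dec; lra. }
    assert (Hx : forall k, 0 < d * / (INR k + 1) <= d).
    { intros k. pose proof (inv_nat_bounds k). nra. }
    exists (fun k => x1 + d * / (INR k + 1)). split; [|split; [|split]].
    + intros k. specialize (Hx k). lra.
    + intros i j. pose proof (Hx i). pose proof (Hx j).
      destruct (Rlt_dec x1 0) as [Hneg|Hpos]; [|apply Rmult_lt_0_compat; lra].
      rewrite <- Rmult_opp_opp. apply Rmult_lt_0_compat; lra.
    + intros i j Hij. apply (inv_nat_inj d); lra.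
    + intros eps Heps.
      destruct (proj1 (filterlim_locally f 0) Hf (mkposreal eps Heps)) as [e He].
      destruct (inv_nat_small d e ltac:(lra) (cond_pos e)) as [K HK].
      exists K. intros k Hk. specialize (HK k Hk). specialize (Hx k).
      assert (Hb : Rabs (f (x1 + d * / (INR k + 1)) - 0) < eps).
      { apply He; [|lra]. change (Rabs (x1 + d * / (INR k + 1) - x1) < e).
        rewrite Rabs_pos_eq; lra. }
      apply Rabs_lt_between in Hb. lra.
  - set (d := (if Rlt_dec 0 x2 then Rmin (x2 - x1) x2 else x2 - x1) / 2).
    assert (Hd : 0 < d /\ d < x2 - x1 /\ (0 < x2 -> 0 < x2 - d)).
    { unfold d, Rmin. repeat destruct Rlt_dec; repeat destruct Rle_dec; lra. }
    assert (Hx : forall k, 0 < d * / (INR k + 1) <= d).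
    { intros k. pose proof (inv_nat_bounds k). nra. }
    exists (fun k => x2 - d * / (INR k + 1)). split; [|split; [|split]].
    + intros k. specialize (Hx k). lra.
    + intros i j. pose proof (Hx i). pose proof (Hx j).
      destruct (Rlt_dec 0 x2) as [Hpos|Hneg]; [apply Rmult_lt_0_compat; lra|].
      rewrite <- Rmult_opp_opp. apply Rmult_lt_0_compat; lra.
    + intros i j Hij. apply (inv_nat_inj d); lra.
    + intros eps Heps.
      destruct (proj1 (filterlim_locally f 0) Hf (mkposreal eps Heps)) as [e He].
      destruct (inv_nat_small d e ltac:(lra) (cond_pos e)) as [K HK].
      exists K. intros k Hk. specialize (HK k Hk). specialize (Hx k).
      assert (Hb : Rabs (f (x2 - d * / (INR k + 1)) - 0) < eps).
      { apply He; [|lra]. change (Rabs (x2 - d * / (INR k + 1) - x2) < e).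
        rewrite Rabs_minus_sym, Rabs_pos_eq; lra. }
      apply Rabs_lt_between in Hb. lra.
Qed.

(** The solution starting at 0 is a primitive of b; its periodicity makes the mean of b vanish, so b
    has a trigonometric primitive h, and P = 0, Q = 1 fit. *)
Lemma zero_coefficient_composition (a b : R -> R) (u : R -> R -> R) :
  trig_poly b -> is_solution_map a b u -> global_center u -> (forall t, a t = 0) ->
  exists P Q h, poly_fun P /\ poly_fun Q /\ trig_poly h /\
    forall t, a t = P (h t) * Derive h t /\ b t = Q (h t) * Derive h t.
Proof.
  intros Hb Hu Hcenter Ha.
  destruct (trig_poly_primitive b Hb) as [B [c [HB HB']]].
  assert (Hc : c = 0).
  { pose proof PI_RGT_0 as Hpi.
    assert (H : u 0 0 - (B 0 + c * 0) = u (2 * PI) 0 - (B (2 * PI) + c * (2 * PI))).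
    { apply (derive_zero_eq (fun t => u t 0 - (B t + c * t))); [lra|]. intros t _.
      assert (H0 : (a t * Rabs (u t 0) + b t) - ((b t - c) + c) = 0) by (rewrite Ha; ring).
      assert (Hd : is_derive (fun t => u t 0 - (B t + c * t)) t
        ((a t * Rabs (u t 0) + b t) - ((b t - c) + c))).
      { apply (is_derive_minus (V := R_NormedModule)); [exact (proj2 (Hu 0) t)|].
        apply (is_derive_plus (V := R_NormedModule)); [apply HB'|].
        auto_derive; [exact I | ring]. }
      rewrite H0 in Hd. exact Hd. }
    rewrite (Hcenter 0), (trig_poly_2PI B HB) in H. nra. }
  exists (fun _ => 0), (fun _ => 1), B.
  split; [exists 0%nat, (fun _ => 0); intros y; simpl; ring|].
  split; [exists 0%nat, (fun _ => 1); intros y; simpl; ring|].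
  split; [exact HB|]. intros t.
  rewrite (is_derive_unique _ _ _ (HB' t)), Ha, Hc. split; ring.
Qed.

Theorem theorem1p2 (a b : R -> R) (u : R -> R -> R) :
  trig_poly a -> trig_poly b -> simple_zeros b ->
  is_solution_map a b u ->
  (exists (x1 x2 : R) (t1 t2 : R -> R), x1 < x2 /\
     (forall x : R, x1 < x < x2 ->
        0 < t1 x /\ t1 x < t2 x /\ t2 x < 2 * PI /\
        u (t1 x) x = 0 /\ u (t2 x) x = 0 /\
        (forall t : R, 0 < t < 2 * PI -> u t x = 0 -> t = t1 x \/ t = t2 x) /\
        Derive (fun s => u s x) (t1 x) <> 0 /\
        Derive (fun s => u s x) (t2 x) <> 0) /\
     (filterlim (fun x => t2 x - t1 x) (at_right x1) (locally 0) \/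
      filterlim (fun x => t2 x - t1 x) (at_left x2) (locally 0))) ->
  (global_center u <->
   exists (P Q h : R -> R), poly_fun P /\ poly_fun Q /\ trig_poly h /\
     forall t : R, a t = P (h t) * Derive h t /\ b t = Q (h t) * Derive h t).
Proof.
  intros Ha Hb _ Hu (x1 & x2 & t1 & t2 & H12 & Hzeros & Hlim). split.
  - intros Hcenter.
    (* A nonzero a makes A nonconstant, which provides the poles at 0 and infinity. *)
    destruct (classic (exists t, a t <> 0)) as [Hnz | Hz].
    2: { apply (zero_coefficient_composition a b u Hb Hu Hcenter).
         intros t. apply NNPP. intros H. apply Hz. now exists t. }
    destruct (center_primitive a b u Ha Hb Hu Hcenter) as (A & HA & HA' & HA0 & Ep & Em).
    assert (HA2 : A (2 * PI) = 0) by now rewrite (trig_poly_2PI A HA).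
    destruct (endpoint_sequence x1 x2 _ H12 Hlim) as (x & Hx & Hsign & Hinj & Hclose).
    assert (Hid : forall k, A (t1 (x k)) = A (t2 (x k)) /\
      a (t1 (x k)) * b (t2 (x k)) = a (t2 (x k)) * b (t1 (x k))).
    { intros k. apply (zeros_identities a b u Ha Hb Hu Hcenter A x1 x2 t1 t2); auto.
      intros H. specialize (Hsign k k). rewrite H in Hsign. lra. }
    assert (Hinj' : forall i j,
      t1 (x i) = t1 (x j) \/ t2 (x i) = t2 (x j) -> i = j).
    { intros i j Hij. apply Hinj.
      apply (zeros_injective a b u Hb Hu Hcenter A x1 x2 t1 t2); auto. }
    destruct (CircleComposition.composition_of_pairs (A := A) (a := a) (b := b)
      (r := fun k => t1 (x k)) (s := fun k => t2 (x k))) as (P & Q & h & [HP HQ Hh Hab]); auto.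
    + intros k. destruct (Hzeros (x k) (Hx k)) as (P1 & P2 & P3 & _). auto.
    + intros i j Hij. apply Hinj'. now left.
    + intros i j Hij. apply Hinj'. now right.
    + intros k. apply Hid.
    + intros k. apply Hid.
    + intros eps Heps. destruct (Hclose eps Heps) as [K HK]. exists K. intros k Hk.
      apply HK. now apply (ssrbool.elimT ssrnat.leP).
    + exists P, Q, h. auto.
  - intros (P & Q & h & HP & HQ & Hh & Hab).
    exact (composition_global_center a b u P Q h Ha Hu HP HQ Hh Hab).
Qed.
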